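(* Let $\lambda$ be a regular cardinal. Let $\mathfrak{A}$ and $\mathfrak{B}$ be $\lambda$-algebroidal categories all of whose morphisms are monomorphisms, and suppose that $\mathfrak{B}_{<\lambda}$ has the joint embedding property and the amalgamation property. Let $\mathfrak{C}$ be any category and let $F:\mathfrak{A}\to\mathfrak{C}$, $G:\mathfrak{B}\to\mathfrak{C}$ be functors such that (1) $F$ is $\lambda$-cocontinuous and $\mu_{<\lambda}$-cocontinuous for all $\mu<\lambda$; (2) $F$ preserves $\lambda$-smallness with respect to $G$; (3) $G$ is $\lambda_{<\lambda}$-cocontinuous; (4) $G$ preserves monomorphisms; (5) for every $A\in\mathfrak{A}_{<\lambda}$ and every $B\in\mathfrak{B}_{<\lambda}$ there are at most $\lambda$ morphisms in $\mathfrak{C}(FA\to GB)$. Then the comma category $(F\downarrow G)$ contains an $(F\downarrow G)$-universal, $(F\downarrow G)_{<\lambda}$-homogeneous object if and only if $\mathfrak{A}_{<\lambda}$ has the $(F\restriction_{\mathfrak{A}_{<\lambda}},G\restriction_{\mathfrak{B}_{<\lambda}})$-joint embedding property and the $(F\restriction_{\mathfrak{A}_{<\lambda}},G\restriction_{\mathfrak{B}_{<\lambda}})$-amalgamation property.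
   Context: Comma category: for functors $F:\mathfrak{A}\to\mathfrak{C}$, $G:\mathfrak{B}\to\mathfrak{C}$, $(F\downarrow G)$ has objects triples $(A,f,B)$ with $A\in\mathfrak{A}$, $B\in\mathfrak{B}$, $f:FA\to GB$; morphisms $(A,f,B)\to(A',f',B')$ are pairs $(a,b)$ with $a:A\to A'$ in $\mathfrak{A}$, $b:B\to B'$ in $\mathfrak{B}$ and $f'\circ Fa=Gb\circ f$. A regular cardinal $\lambda$ (and any ordinal) is regarded as a category whose objects are the ordinals $i<\lambda$ with a unique morphism $i\to j$ iff $i\le j$; a $\lambda$-chain in $\mathfrak{C}$ is a functor $\lambda\to\mathfrak{C}$. A compatible cocone of a functor $H:\mathfrak{D}\to\mathfrak{C}$ is $(S,(f_X)_{X})$ with $f_X:HX\to S$ and $f_Y\circ Hh=f_X$ for all $h:X\to Y$; it is limiting (and $S$ is a colimit) if every compatible cocone factors through it by a unique mediating morphism. An object $A$ is $\lambda$-small if whenever $(S,(f_i)_{i<\lambda})$ is a limiting cocone of a $\lambda$-chain $H$ and $h:A\to S$, there is $j<\lambda$ and $g:A\to Hj$ with $h=f_j\circ g$. $\mathfrak{C}_{<\lambda}$ is the full subcategory of $\lambda$-small objects. $\mathfrak{C}$ is semi-$\lambda$-algebroidal if for every $\mu\le\lambda$ every $\mu$-chain in $\mathfrak{C}_{<\lambda}$ has a colimit in $\mathfrak{C}$ and every object of $\mathfrak{C}$ is the colimit of a $\lambda$-chain in $\mathfrak{C}_{<\lambda}$; it is $\lambda$-algebroidal if moreover $\mathfrak{C}_{<\lambda}$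 has at most $\lambda$ isomorphism classes of objects and at most $\lambda$ morphisms between any two of its objects. A functor $F$ is $\lambda$-cocontinuous if it maps limiting cocones of $\lambda$-chains to limiting cocones; for semi-$\lambda$-algebroidal domain and $\mu\le\lambda$, $F$ is $\mu_{<\lambda}$-cocontinuous if it maps limiting cocones of $\mu$-chains of $\lambda$-small objects to limiting cocones. $F$ preserves $\lambda$-smallness with respect to $G$ if for every $\lambda$-chain $H$ in $\mathfrak{B}$ with limiting cocone $(B,(g_i)_{i<\lambda})$, every $A\in\mathfrak{A}_{<\lambda}$ and every $f:FA\to GB$, there are $j<\lambda$ and $h:FA\to GHj$ with $Gg_j\circ h=f$. For a full subcategory $\mathfrak{C}^*$ of $\mathfrak{C}$ and $U\in\mathfrak{C}$: $U$ is $\mathfrak{C}^*$-universal if every $A\in\mathfrak{C}^*$ has a morphism $A\to U$; $U$ is $\mathfrak{C}^*$-homogeneous if for all $A\in\mathfrak{C}^*$ and $f,g:A\to U$ there is an automorphism $h$ of $U$ with $h\circ f=g$. $\mathfrak{C}^*$ has the joint embedding property if any two of its objects admit morphisms into a common object of $\mathfrak{C}^*$, and the amalgamation property if for all $f:A\to B$, $g:A\to C$ in $\mathfrak{C}^*$ there are $D\in\mathfrak{C}^*$, $\hat f:C\to D$, $\hat g:B\to D$ with $\hat g\circ f=\hat f\circ g$. $(F,G)$-joint embedding property of $\mathfrak{A}$: for all $B_1,B_2\in\mathfrak{A}$, $T\in\mathfrak{B}$, $h_i:FB_i\to GT$, there exist $C\in\mathfrak{A}$, $T'\in\mathfrak{B}$,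 $f_i:B_i\to C$, $h:FC\to GT'$, $k_i:T\to T'$ ($i=1,2$) with $h\circ Ff_i=Gk_i\circ h_i$. $(F,G)$-amalgamation property of $\mathfrak{A}$: for all $A,B_1,B_2\in\mathfrak{A}$, $f_i:A\to B_i$, $T\in\mathfrak{B}$, $h_i:FB_i\to GT$ with $h_1\circ Ff_1=h_2\circ Ff_2$, there exist $C\in\mathfrak{A}$, $g_i:B_i\to C$ with $g_1\circ f_1=g_2\circ f_2$, $T'\in\mathfrak{B}$, $k:T\to T'$ and $h:FC\to GT'$ with $h\circ Fg_i=Gk\circ h_i$ for $i=1,2$. *)

(* Defs.v *)
From Stdlib Require Import ProofIrrelevance.


Record Category := {
  Obj : Type;
  Hom : Obj -> Obj -> Type;
  idm : forall A, Hom A A;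
  comp : forall A B C, Hom B C -> Hom A B -> Hom A C;
  comp_idl : forall A B (f : Hom A B), comp A B B (idm B) f = f;
  comp_idr : forall A B (f : Hom A B), comp A A B f (idm A) = f;
  comp_assoc : forall A B C D (f : Hom A B) (g : Hom B C) (h : Hom C D),
      comp A C D h (comp A B C g f) = comp A B D (comp B C D h g) f }.

Arguments Hom {_} _ _.
Arguments idm {_} _.
Arguments comp {_ _ _ _} _ _.
Arguments comp_idl {_ _ _} _.
Arguments comp_idr {_ _ _} _.
Arguments comp_assoc {_ _ _ _ _} _ _ _.

Record Functor (C D : Category) := {
  fobj : Obj C -> Obj D;
  fmap : forall A B : Obj C, Hom A B -> Hom (fobj A) (fobj B);
  fmap_id : forall A : Obj C, fmap A A (idm A) = idm (fobj A);
  fmap_comp : forall (A B E : Obj C) (f : Hom A B) (g : Hom B E),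
      fmap A E (comp g f) = comp (fmap B E g) (fmap A B f) }.

Arguments fobj {_ _} _ _.
Arguments fmap {_ _} _ {_ _} _.
Arguments fmap_id {_ _} _ _.
Arguments fmap_comp {_ _} _ {_ _ _} _ _.

Definition Fcomp {C D E : Category} (F : Functor D E) (H : Functor C D)
  : Functor C E.
Proof.
  refine {| fobj := fun X => fobj F (fobj H X);
            fmap := fun X Y h => fmap F (fmap H h) |}.
  - intros A. rewrite (fmap_id H), (fmap_id F). reflexivity.
  - intros A B E' f g. rewrite (fmap_comp H), (fmap_comp F). reflexivity.
Defined.

Definition FullSub (C : Category) (P : Obj C -> Prop) : Category.
Proof.
  refine {| Obj := {A : Obj C | P A};
            Hom := fun X Y => Hom (proj1_sig X) (proj1_sig Y);
            idm := fun X => idm (proj1_sig X);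
            comp := fun X Y Z g f => comp g f |}.
  - intros; apply comp_idl.
  - intros; apply comp_idr.
  - intros; apply comp_assoc.
Defined.

Definition Incl (C : Category) (P : Obj C -> Prop) : Functor (FullSub C P) C.
Proof.
  refine {| fobj := fun X : Obj (FullSub C P) => proj1_sig X;
            fmap := fun X Y (h : Hom X Y) => (h : Hom (proj1_sig X) (proj1_sig Y)) |}.
  - intros; reflexivity.
  - intros; reflexivity.
Defined.

Definition Restrict {C D : Category} (F : Functor C D) (P : Obj C -> Prop)
  : Functor (FullSub C P) D := Fcomp F (Incl C P).

Definition is_mono {C : Category} {A B : Obj C} (f : Hom A B) : Prop :=
  forall X (g h : Hom X A), comp f g = comp f h -> g = h.

Definition is_iso {C : Category} {A B : Obj C} (f : Hom A B) : Prop :=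
  exists g : Hom B A, comp g f = idm A /\ comp f g = idm B.

Definition isomorphic {C : Category} (A B : Obj C) : Prop :=
  exists f : Hom A B, is_iso f.

Record WO := {
  wcar : Type;
  wlt : wcar -> wcar -> Prop;
  wlt_irrefl : forall x, ~ wlt x x;
  wlt_trans : forall x y z, wlt x y -> wlt y z -> wlt x z;
  wlt_total : forall x y, wlt x y \/ x = y \/ wlt y x;
  wlt_wf : well_founded wlt }.

Arguments wlt {_} _ _.

Definition wle {l : WO} (x y : wcar l) : Prop := x = y \/ wlt x y.

Lemma wle_refl {l : WO} (x : wcar l) : wle x x.
Proof. left; reflexivity. Qed.

Lemma wle_trans {l : WO} {x y z : wcar l} : wle x y -> wle y z -> wle x z.
Proof.
  intros [-> | H1] [-> | H2]; unfold wle; auto.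
  right; eapply wlt_trans; eauto.
Qed.

Definition WOcat (l : WO) : Category.
Proof.
  refine {| Obj := wcar l;
            Hom := fun i j => wle i j;
            idm := fun i => wle_refl i;
            comp := fun i j k (g : wle j k) (f : wle i j) => wle_trans f g |}.
  - intros; apply proof_irrelevance.
  - intros; apply proof_irrelevance.
  - intros; apply proof_irrelevance.
Defined.

Definition ord_le (mu l : WO) : Prop :=
  exists e : wcar mu -> wcar l, forall i j, wlt i j -> wlt (e i) (e j).
Definition ord_lt (mu l : WO) : Prop := ord_le mu l /\ ~ ord_le l mu.

Definition injective {X Y : Type} (e : X -> Y) : Prop :=
  forall x y, e x = e y -> x = y.

(* l is a regular (infinite) cardinal: an infinite initial ordinal every
   cofinal subset of which has cardinality l. *)
Definition regular_cardinal (l : WO) : Prop :=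
  inhabited (wcar l) /\
  (forall i : wcar l, exists j, wlt i j) /\
  (forall k : wcar l, ~ exists e : wcar l -> {j : wcar l | wlt j k}, injective e) /\
  (forall X : wcar l -> Prop, (forall i, exists x, X x /\ wle i x) ->
     exists e : wcar l -> {x : wcar l | X x}, injective e).

Definition is_cocone {D C : Category} (H : Functor D C) (S : Obj C)
  (f : forall X, Hom (fobj H X) S) : Prop :=
  forall X Y (h : Hom X Y), comp (f Y) (fmap H h) = f X.

Definition is_limiting {D C : Category} (H : Functor D C) (S : Obj C)
  (f : forall X, Hom (fobj H X) S) : Prop :=
  is_cocone H S f /\
  forall S' (f' : forall X, Hom (fobj H X) S'), is_cocone H S' f' ->
    exists! m : Hom S S', forall X, comp m (f X) = f' X.

Definition small (l : WO) {C : Category} (A : Obj C) : Prop :=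
  forall (H : Functor (WOcat l) C) (S : Obj C) (f : forall i, Hom (fobj H i) S),
    is_limiting H S f ->
    forall h : Hom A S, exists (j : wcar l) (g : Hom A (fobj H j)), h = comp (f j) g.

Definition SmallSub (l : WO) (C : Category) : Category := FullSub C (@small l C).

Definition semi_algebroidal (l : WO) (C : Category) : Prop :=
  (forall mu : WO, ord_le mu l ->
     forall H : Functor (WOcat mu) C, (forall i, small l (fobj H i)) ->
       exists S (f : forall i, Hom (fobj H i) S), is_limiting H S f) /\
  (forall X : Obj C, exists H : Functor (WOcat l) C,
       (forall i, small l (fobj H i)) /\
       exists f : forall i, Hom (fobj H i) X, is_limiting H X f).

Definition algebroidal (l : WO) (C : Category) : Prop :=
  semi_algebroidal l C /\
  (* at most l isomorphism classes of l-small objects *)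
  (exists code : Obj (SmallSub l C) -> wcar l,
      forall A B, code A = code B -> isomorphic A B) /\
  (forall A B : Obj C, small l A -> small l B ->
      exists e : Hom A B -> wcar l, injective e).

Definition all_mono (C : Category) : Prop :=
  forall (A B : Obj C) (f : Hom A B), is_mono f.

Definition cocone_image {D C E : Category} (F : Functor C E) (H : Functor D C)
  (S : Obj C) (f : forall X, Hom (fobj H X) S)
  : forall X, Hom (fobj (Fcomp F H) X) (fobj F S) :=
  fun X => fmap F (f X).

Definition cocontinuous (l : WO) {C E : Category} (F : Functor C E) : Prop :=
  forall (H : Functor (WOcat l) C) S (f : forall i, Hom (fobj H i) S),
    is_limiting H S f -> is_limiting (Fcomp F H) (fobj F S) (cocone_image F H S f).

Definition small_cocontinuous (mu l : WO) {C E : Category} (F : Functor C E) : Prop :=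
  forall (H : Functor (WOcat mu) C), (forall i, small l (fobj H i)) ->
    forall S (f : forall i, Hom (fobj H i) S),
    is_limiting H S f -> is_limiting (Fcomp F H) (fobj F S) (cocone_image F H S f).

Definition preserves_smallness (l : WO) {A B C : Category}
  (F : Functor A C) (G : Functor B C) : Prop :=
  forall (H : Functor (WOcat l) B) (S : Obj B) (g : forall i, Hom (fobj H i) S),
    is_limiting H S g ->
    forall X : Obj A, small l X ->
    forall f : Hom (fobj F X) (fobj G S),
      exists (j : wcar l) (h : Hom (fobj F X) (fobj G (fobj H j))),
        comp (fmap G (g j)) h = f.

Definition preserves_mono {B C : Category} (G : Functor B C) : Prop :=
  forall (X Y : Obj B) (f : Hom X Y), is_mono f -> is_mono (fmap G f).

Record CommaObj {A B C : Category} (F : Functor A C) (G : Functor B C) := {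
  cA : Obj A;
  cB : Obj B;
  cf : Hom (fobj F cA) (fobj G cB) }.

Arguments cA {_ _ _ _ _} _.
Arguments cB {_ _ _ _ _} _.
Arguments cf {_ _ _ _ _} _.
Arguments Build_CommaObj {_ _ _ _ _} _ _ _.

Definition CommaHom {A B C : Category} (F : Functor A C) (G : Functor B C)
  (X Y : CommaObj F G) : Type :=
  { p : Hom (cA X) (cA Y) * Hom (cB X) (cB Y) |
      comp (cf Y) (fmap F (fst p)) = comp (fmap G (snd p)) (cf X) }.

Lemma sig_eq_pi {T : Type} (P : T -> Prop) (x y : sig P) :
  proj1_sig x = proj1_sig y -> x = y.
Proof.
  destruct x as [x px], y as [y py]; simpl; intros ->.
  f_equal; apply proof_irrelevance.
Qed.

Definition comma_id {A B C : Category} (F : Functor A C) (G : Functor B C)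
  (X : CommaObj F G) : CommaHom F G X X.
Proof.
  refine (exist _ (idm (cA X), idm (cB X)) _).
  simpl. rewrite (fmap_id F), (fmap_id G), comp_idr, comp_idl. reflexivity.
Defined.

Definition comma_comp {A B C : Category} (F : Functor A C) (G : Functor B C)
  (X Y Z : CommaObj F G) (q : CommaHom F G Y Z) (p : CommaHom F G X Y)
  : CommaHom F G X Z.
Proof.
  refine (exist _ (comp (fst (proj1_sig q)) (fst (proj1_sig p)),
                   comp (snd (proj1_sig q)) (snd (proj1_sig p))) _).
  destruct p as [[a1 b1] e1], q as [[a2 b2] e2]; simpl in *.
  rewrite (fmap_comp F), (fmap_comp G), comp_assoc, e2, <- comp_assoc, e1,
    comp_assoc. reflexivity.
Defined.

Definition Comma {A B C : Category} (F : Functor A C) (G : Functor B C) : Category.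
Proof.
  refine {| Obj := CommaObj F G;
            Hom := CommaHom F G;
            idm := comma_id F G;
            comp := comma_comp F G |}.
  - intros X Y [[a b] e]; apply sig_eq_pi; simpl.
    rewrite !comp_idl; reflexivity.
  - intros X Y [[a b] e]; apply sig_eq_pi; simpl.
    rewrite !comp_idr; reflexivity.
  - intros X Y Z W [[a1 b1] e1] [[a2 b2] e2] [[a3 b3] e3]; apply sig_eq_pi; simpl.
    rewrite !comp_assoc; reflexivity.
Defined.

(* U is P-universal, where P is (the object predicate of) a full subcategory *)
Definition universal_for {C : Category} (P : Obj C -> Prop) (U : Obj C) : Prop :=
  forall A, P A -> exists f : Hom A U, True.

Definition homogeneous_for {C : Category} (P : Obj C -> Prop) (U : Obj C) : Prop :=
  forall A, P A -> forall f g : Hom A U,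
    exists h : Hom U U, is_iso h /\ comp h f = g.

Definition jep (C : Category) : Prop :=
  forall A B : Obj C, exists D (f : Hom A D) (g : Hom B D), True.

Definition ap (C : Category) : Prop :=
  forall (A B E : Obj C) (f : Hom A B) (g : Hom A E),
    exists D (f' : Hom E D) (g' : Hom B D), comp g' f = comp f' g.

Definition fg_jep {A B C : Category} (F : Functor A C) (G : Functor B C) : Prop :=
  forall (B1 B2 : Obj A) (T : Obj B)
         (h1 : Hom (fobj F B1) (fobj G T)) (h2 : Hom (fobj F B2) (fobj G T)),
    exists (D : Obj A) (T' : Obj B) (f1 : Hom B1 D) (f2 : Hom B2 D)
           (h : Hom (fobj F D) (fobj G T')) (k1 k2 : Hom T T'),
      comp h (fmap F f1) = comp (fmap G k1) h1 /\
      comp h (fmap F f2) = comp (fmap G k2) h2.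

Definition fg_ap {A B C : Category} (F : Functor A C) (G : Functor B C) : Prop :=
  forall (X B1 B2 : Obj A) (f1 : Hom X B1) (f2 : Hom X B2) (T : Obj B)
         (h1 : Hom (fobj F B1) (fobj G T)) (h2 : Hom (fobj F B2) (fobj G T)),
    comp h1 (fmap F f1) = comp h2 (fmap F f2) ->
    exists (D : Obj A) (g1 : Hom B1 D) (g2 : Hom B2 D),
      comp g1 f1 = comp g2 f2 /\
      exists (T' : Obj B) (k : Hom T T') (h : Hom (fobj F D) (fobj G T')),
        comp h (fmap F g1) = comp (fmap G k) h1 /\
        comp h (fmap F g2) = comp (fmap G k) h2.

(* Main.v *)
(** The comma category (F ↓ G) is itself l-algebroidal with monic morphisms, an object
    of it being l-small iff both of its components are: colimits of chains are
    computed componentwise because F preserves them, and an object (A, f, B) is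
    decomposed by writing A and B as colimits of chains of small objects A i, B j and
    factoring f on F (A i) through G (B j) for a suitable j = j(i).  By the
    Droste-Göbel form of Fraïssé's theorem, the universal homogeneous object
    therefore exists iff the l-small objects of (F ↓ G) have the joint embedding and
    amalgamation properties, and given these properties for the small objects of B
    this amounts to the (F,G)-versions for the small objects of A. *)

From Stdlib Require Import ProofIrrelevance Classical ClassicalEpsilon.
From Stdlib Require Import FunctionalExtensionality Eqdep Wellfounded.
Require Import Defs.

(** The smallness test for a comma object ranges over all limiting cocones of the comma category,
    and nothing is known in advance about the components of such a cocone. The remedy is to have
    colimits in A and B for chains of arbitrary, not only small, objects: the componentwise colimit
    then exists and can be compared with the given one. Monomorphisms keep choices coherent.
    Factorizations through a monomorphism are unique, so those chosen independently form chains and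
    cocones, and a comma square may be checked after composing with a monic leg in the image of [G].
    Regularity supplies the stages: fewer than [l] requirements, each met from some stage on, are
    met at a common stage. The existence half of Fraïssé's theorem goes through one extension
    property, [saturated]; reaching it in [l] steps takes an injection of l × l into l and stages
    that remain small. *)

Lemma dep_choice (I : Type) (T : I -> Type) (R : forall i, T i -> Prop) :
  (forall i, exists x, R i x) -> exists f : forall i, T i, forall i, R i (f i).
Proof.
  intros H. exists (fun i => proj1_sig (constructive_indefinite_description _ (H i))).
  intros i. destruct (constructive_indefinite_description _ (H i)); assumption.
Qed.

Lemma dep_choice3 (I J : Type) (L : I -> J -> Type) (T : forall i j, L i j -> Type)
  (R : forall i j h, T i j h -> Prop) :
  (forall i j h, exists x, R i j h x) -> exists f, forall i j h, R i j h (f i j h).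
Proof.
  intros H.
  destruct (dep_choice {i : I & {j : J & L i j}}
    (fun s => T (projT1 s) (projT1 (projT2 s)) (projT2 (projT2 s)))
    (fun s => R (projT1 s) (projT1 (projT2 s)) (projT2 (projT2 s)))) as [f Hf].
  { intros s; apply H. }
  exists (fun i j h => f (existT _ i (existT _ j h))).
  intros i j h. exact (Hf (existT _ i (existT _ j h))).
Qed.

(** Each value is picked by [epsilon] whether or not a solution exists, so the recursion carries no
    proof about earlier values; their correctness is shown afterwards by induction. This is why
    [step] may assume it and may take [h] to be total. *)
Lemma wf_dep_choice (W : Type) (lt : W -> W -> Prop) (wf : well_founded lt)
  (T : W -> Type) (P : forall i, (forall j, lt j i -> T j) -> T i -> Prop) :
  (forall i, inhabited (T i)) ->
  (forall i (h : forall j, T j), (forall j, lt j i -> P j (fun k _ => h k) (h j)) ->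
     exists x, P i (fun j _ => h j) x) ->
  exists f : forall i, T i, forall i, P i (fun j _ => f j) (f i).
Proof.
  intros inh step.
  pose (body := fun i (h : forall j, lt j i -> T j) => epsilon (inh i) (P i h)).
  exists (Fix wf T body).
  assert (E : forall i, Fix wf T body i = body i (fun j _ => Fix wf T body j)).
  { intros i. apply Fix_eq. intros j u v Huv. f_equal.
    extensionality k; extensionality hk; apply Huv. }
  intros i. induction i as [i IH] using (well_founded_induction wf).
  rewrite E. unfold body at 2. apply epsilon_spec. apply step, IH.
Qed.

Lemma injective_surj {X Y : Type} (e : X -> Y) :
  inhabited X -> injective e -> exists s : Y -> X, forall x, s (e x) = x.
Proof.
  intros inh He.
  exists (fun y => epsilon inh (fun x => e x = y)).
  intros x. apply He. exact (epsilon_spec inh (fun x' => e x' = e x) (ex_intro _ x eq_refl)).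
Qed.

(** * Well-orders and regular cardinals *)

Section Order.
Context {l : WO}.
Implicit Types i j k : wcar l.

Lemma wle_lt_dec i j : wle i j \/ wlt j i.
Proof. unfold wle; destruct (wlt_total l i j) as [H | [H | H]]; auto. Qed.

Lemma wle_lt_trans i j k : wle i j -> wlt j k -> wlt i k.
Proof. intros [-> | H] H'; [exact H' | exact (wlt_trans l _ _ _ H H')]. Qed.

Lemma wlt_le_trans i j k : wlt i j -> wle j k -> wlt i k.
Proof. intros H [<- | H']; [exact H | exact (wlt_trans l _ _ _ H H')]. Qed.

Lemma wlt_wle i j : wlt i j -> wle i j.
Proof. right; assumption. Qed.

Lemma upper_bound2 i j : exists k, wle i k /\ wle j k.
Proof.
  destruct (wle_lt_dec i j) as [H | H].
  - exists j; split; [exact H | apply wle_refl].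
  - exists i; split; [apply wle_refl | right; exact H].
Qed.

Lemma strict_injective {m : WO} (e : wcar m -> wcar l) :
  (forall x y, wlt x y -> wlt (e x) (e y)) -> injective e.
Proof.
  intros He x y E. destruct (wlt_total m x y) as [H | [H | H]]; auto;
  apply He in H; rewrite E in H; destruct (wlt_irrefl l _ H).
Qed.

Definition seg i : WO.
Proof.
  refine {| wcar := {j | wlt j i};
            wlt := fun x y => wlt (proj1_sig x) (proj1_sig y) |}.
  - intros x; apply wlt_irrefl.
  - intros x y z; apply wlt_trans.
  - intros x y. destruct (wlt_total l (proj1_sig x) (proj1_sig y)) as [H | [H | H]]; auto.
    right; left; apply sig_eq_pi, H.
  - exact (wf_inverse_image _ _ _ (@proj1_sig _ (fun j => wlt j i)) (wlt_wf l)).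
Defined.

Lemma seg_wle i (x y : wcar (seg i)) : wle x y -> wle (proj1_sig x) (proj1_sig y).
Proof. intros [-> | H]; [left; reflexivity | right; exact H]. Qed.

Lemma seg_ord_le i : ord_le (seg i) l.
Proof. exists (@proj1_sig _ _); auto. Qed.

End Order.

Section Regular.
Context {l : WO} (reg : regular_cardinal l).
Implicit Types i j k : wcar l.

Lemma regular_succ i : exists j, wlt i j.
Proof. apply reg. Qed.

(** An unbounded [g] would have cofinal range. Regularity then injects [l] into the range, and
    picking preimages injects [l] into a proper initial segment, which an initial ordinal
    forbids. *)
Lemma seg_sup k (g : wcar (seg k) -> wcar l) : exists b, forall x, wlt (g x) b.
Proof.
  apply NNPP; intros N.
  destruct (proj2 (proj2 (proj2 reg)) (fun j => exists x, j = g x)) as [e He].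
  - intros i. destruct (regular_succ i) as [i' Hi].
    apply NNPP; intros N'. apply N. exists i'. intros x.
    destruct (wle_lt_dec i (g x)) as [H | H].
    + destruct N'; exists (g x); split; [exists x; reflexivity | exact H].
    + exact (wlt_trans l _ _ _ H Hi).
  - destruct (dep_choice _ (fun _ => wcar (seg k)) (fun i x => proj1_sig (e i) = g x)) as [s Hs].
    { intros i; exact (proj2_sig (e i)). }
    apply (proj1 (proj2 (proj2 reg)) k). exists s.
    intros x y E. apply He, sig_eq_pi. rewrite !Hs, E; reflexivity.
Qed.

(** One witness per index, bounded by [seg_sup]. This exchange of quantifiers is the form in which
    regularity is mostly used. *)
Lemma seg_eventually k (P : forall j, wlt j k -> wcar l -> Prop) :
  (forall j h b b', wle b b' -> P j h b -> P j h b') ->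
  (forall j h, exists b, P j h b) -> exists b, forall j h, P j h b.
Proof.
  intros mon ex.
  destruct (dep_choice (wcar (seg k)) (fun _ => wcar l)
    (fun x b => P (proj1_sig x) (proj2_sig x) b)) as [g Hg].
  { intros x; apply ex. }
  destruct (seg_sup k g) as [b Hb]. exists b. intros j h.
  apply (mon _ _ (g (exist _ j h))); [apply wlt_wle, Hb | apply (Hg (exist _ j h))].
Qed.

Lemma injective_unbounded (e : wcar l -> wcar l) :
  injective e -> forall k, exists i, wlt k (e i).
Proof.
  intros He k. destruct (regular_succ k) as [k' Hk].
  apply NNPP; intros N.
  assert (B : forall i, wlt (e i) k').
  { intros i. destruct (wle_lt_dec (e i) k) as [H | H].
    - exact (wle_lt_trans _ _ _ H Hk).
    - destruct N; exists i; exact H. }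
  apply (proj1 (proj2 (proj2 reg)) k').
  exists (fun i => exist _ (e i) (B i)).
  intros x y E. apply He. exact (f_equal (@proj1_sig _ _) E).
Qed.

(** Each fibre of [fst] after [e] is bounded: into a cofinal one regularity would inject [l], and
    [snd] after [e] would carry it on into [seg k]. There are fewer than [l] fibres, so one [b] lies
    strictly above them all; yet [b] belongs to a fibre itself. *)
Lemma no_injection_seg_square k :
  ~ exists e : wcar l -> wcar (seg k) * wcar (seg k), injective e.
Proof.
  intros [e He].
  destruct (seg_eventually k (fun x h b => forall i, fst (e i) = exist _ x h -> wlt i b))
    as [b Hb].
  - intros x h b b' Hbb H i E. exact (wlt_le_trans _ _ _ (H i E) Hbb).
  - intros x h. apply NNPP; intros N.
    destruct (proj2 (proj2 (proj2 reg)) (fun i => fst (e i) = exist _ x h)) as [s Hs].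
    + intros i. apply NNPP; intros N'. apply N. exists i. intros j E.
      destruct (wle_lt_dec i j) as [H | H]; [| exact H].
      destruct N'; exists j; auto.
    + apply (proj1 (proj2 (proj2 reg)) k).
      exists (fun i => snd (e (proj1_sig (s i)))).
      intros i j E. apply Hs, sig_eq_pi, He.
      rewrite (surjective_pairing (e (proj1_sig (s i)))),
        (surjective_pairing (e (proj1_sig (s j)))), E.
      f_equal. rewrite (proj2_sig (s i)), (proj2_sig (s j)); reflexivity.
  - destruct (fst (e b)) as [x h] eqn:E.
    exact (wlt_irrefl l _ (Hb x h b E)).
Qed.

(* Goedel's well-order of l * l: its proper initial segments lie in squares
   of initial segments of l, so they do not exhaust l and a rank function into l
   can be chosen injectively. *)
Lemma pairing : exists p : wcar l * wcar l -> wcar l, injective p.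
Proof.
  destruct (dep_choice (wcar l * wcar l) (fun _ => wcar l)
    (fun q m => wle (fst q) m /\ wle (snd q) m)) as [mx Hmx].
  { intros q; apply upper_bound2. }
  pose (lt := fun q r : wcar l * wcar l => wlt (mx q) (mx r) \/
    (mx q = mx r /\ (wlt (fst q) (fst r) \/ (fst q = fst r /\ wlt (snd q) (snd r))))).
  assert (wf : well_founded lt).
  { assert (H : forall m a b q, mx q = m -> fst q = a -> snd q = b -> Acc lt q).
    { intros m. induction m as [m IHm] using (well_founded_induction (wlt_wf l)).
      intros a. induction a as [a IHa] using (well_founded_induction (wlt_wf l)).
      intros b. induction b as [b IHb] using (well_founded_induction (wlt_wf l)).
      intros q Em Ea Eb. constructor. intros r [H | [E [H | [E' H]]]].
      - rewrite Em in H. exact (IHm _ H _ _ r eq_refl eq_refl eq_refl).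
      - rewrite Ea in H. rewrite Em in E. exact (IHa _ H _ r E eq_refl eq_refl).
      - rewrite Eb in H. rewrite Ea in E'. rewrite Em in E. exact (IHb _ H r E E' eq_refl). }
    intros q; exact (H _ _ _ q eq_refl eq_refl eq_refl). }
  destruct (wf_dep_choice _ lt wf (fun _ => wcar l)
    (fun q h x => forall r hr, h r hr <> x)) as [p Hp].
  - intros _; apply reg.
  - intros q h _. apply NNPP; intros N.
    destruct (dep_choice (wcar l) (fun _ => {r | lt r q})
      (fun x s => h (proj1_sig s) = x)) as [s Hs].
    { intros x. apply NNPP; intros N'. apply N. exists x. intros r hr E.
      apply N'. exists (exist _ r hr). exact E. }
    destruct (regular_succ (mx q)) as [k Hk].
    assert (B : forall r, lt r q -> wlt (fst r) k /\ wlt (snd r) k).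
    { intros r Hr. assert (M : wlt (mx r) k).
      { destruct Hr as [H | [E _]]; [exact (wlt_trans l _ _ _ H Hk) | rewrite E; exact Hk]. }
      split; refine (wle_lt_trans _ _ _ _ M); apply Hmx. }
    apply (no_injection_seg_square k).
    exists (fun x => (exist (fun j => wlt j k) _ (proj1 (B _ (proj2_sig (s x)))),
                      exist (fun j => wlt j k) _ (proj2 (B _ (proj2_sig (s x)))))).
    intros x y E. injection E as E1 E2.
    rewrite <- (Hs x), <- (Hs y).
    assert (s x = s y) as -> by (apply sig_eq_pi, injective_projections; assumption).
    reflexivity.
  - exists p. intros q r E. apply NNPP; intros N.
    assert (T : lt q r \/ lt r q).
    { unfold lt. destruct (wlt_total l (mx q) (mx r)) as [H | [H | H]]; auto.
      destruct (wlt_total l (fst q) (fst r)) as [H1 | [H1 | H1]]; auto.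
      destruct (wlt_total l (snd q) (snd r)) as [H2 | [H2 | H2]]; auto 6.
      destruct N. apply injective_projections; assumption. }
    destruct T as [T | T]; [apply (Hp r q T E) | apply (Hp q r T (eq_sym E))].
Qed.

End Regular.
(** * Chains and their colimits *)

Notation "g ∘ f" := (comp g f) (at level 40, left associativity).

Lemma limiting_epi {D K : Category} {H : Functor D K} {S f} :
  is_limiting H S f -> forall X (a b : Hom S X), (forall i, a ∘ f i = b ∘ f i) -> a = b.
Proof.
  intros [Hc Hu] X a b E.
  destruct (Hu X (fun i => b ∘ f i)) as [m [_ Um]].
  { intros i j h. rewrite <- comp_assoc, Hc; reflexivity. }
  rewrite <- (Um a), <- (Um b); auto.
Qed.

Lemma limiting_mediate {D K : Category} {H : Functor D K} {S f} :
  is_limiting H S f -> forall S' f', is_cocone H S' f' ->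
  exists m : Hom S S', forall i, m ∘ f i = f' i.
Proof. intros [_ Hu] S' f' Hf'. destruct (Hu S' f' Hf') as [m [Hm _]]; eauto. Qed.

Lemma limiting_intro {D K : Category} {H : Functor D K} {S f} :
  is_cocone H S f ->
  (forall S' f', is_cocone H S' f' -> exists m : Hom S S', forall i, m ∘ f i = f' i) ->
  (forall X (a b : Hom S X), (forall i, a ∘ f i = b ∘ f i) -> a = b) ->
  is_limiting H S f.
Proof.
  intros Hc Hm He. split; [exact Hc |]. intros S' f' Hf'.
  destruct (Hm S' f' Hf') as [m Em]. exists m; split; [exact Em |].
  intros m' Em'. apply He. intros i; rewrite Em, Em'; reflexivity.
Qed.

Lemma small_retract {l : WO} {K : Category} {V W : Obj K} (s : Hom V W) (r : Hom W V) :
  r ∘ s = idm V -> small l W -> small l V.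
Proof.
  intros E HW H S f L h. destruct (HW H S f L (h ∘ r)) as (j & g & Eg).
  exists j, (g ∘ s). rewrite comp_assoc, <- Eg, <- comp_assoc, E, comp_idr; reflexivity.
Qed.

(** The factorizations [n] form a cocone because [p] is monic, and the mediating morphism is a
    section of [p]; a monomorphism with a section is invertible. *)
Lemma covering_iso {D K : Category} {H : Functor D K} {U : Obj K} {u} :
  is_limiting H U u -> forall S (p : Hom S U), is_mono p ->
  (forall i, exists n, p ∘ n = u i) -> is_iso p.
Proof.
  intros L S p Mp cov. destruct (dep_choice _ _ _ cov) as [n Hn].
  destruct (limiting_mediate L S n) as [N HN].
  { intros i j h. apply Mp. rewrite comp_assoc, !Hn. apply L. }
  assert (E : p ∘ N = idm U).
  { apply (limiting_epi L). intros i. rewrite <- comp_assoc, HN, Hn, comp_idl; reflexivity. }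
  exists N; split; [| exact E].
  apply Mp. rewrite comp_assoc, E, comp_idl, comp_idr; reflexivity.
Qed.

Definition reindex {nu mu : WO} (e : wcar nu -> wcar mu)
  (mon : forall i j, wle i j -> wle (e i) (e j)) : Functor (WOcat nu) (WOcat mu).
Proof.
  refine {| fobj := (e : Obj (WOcat nu) -> Obj (WOcat mu)); fmap := mon |};
  intros; apply (proof_irrelevance (wle _ _)).
Defined.

Lemma fmap_wle {mu : WO} {K : Category} (H : Functor (WOcat mu) K) {i j k : wcar mu}
  (f : wle i j) (g : wle j k) (h : wle i k) :
  fmap H (g : @Hom (WOcat mu) j k) ∘ fmap H (f : @Hom (WOcat mu) i j)
  = fmap H (h : @Hom (WOcat mu) i k).
Proof. rewrite <- (fmap_comp H). f_equal; apply (proof_irrelevance (wle _ _)). Qed.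

Lemma fmap_wle_refl {mu : WO} {K : Category} (H : Functor (WOcat mu) K) {i : wcar mu}
  (h : wle i i) : fmap H (h : @Hom (WOcat mu) i i) = idm (fobj H i).
Proof. rewrite <- (fmap_id H). f_equal; apply (proof_irrelevance (wle _ _)). Qed.

(** The leg at [i] passes through any [e x] above [i]; two such choices agree because their indices
    are comparable. *)
Lemma cofinal_extend {nu mu : WO} {K : Category} (H : Functor (WOcat mu) K)
  (e : wcar nu -> wcar mu) (mon : forall i j, wle i j -> wle (e i) (e j))
  (cof : forall i, exists x, wle i (e x)) S f :
  is_cocone (Fcomp H (reindex e mon)) S f ->
  exists f', is_cocone H S f' /\ forall x, f' (e x) = f x.
Proof.
  intros Hf.
  assert (T : forall i : Obj (WOcat mu), exists t : Hom (fobj H i) S,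
    forall x (h : @Hom (WOcat mu) i (e x)), f x ∘ fmap H h = t).
  { intros i. destruct (cof i) as [x0 h0].
    exists (f x0 ∘ fmap H (h0 : @Hom (WOcat mu) i (e x0))). intros x h.
    destruct (wle_lt_dec x x0) as [Hx | Hx]; [| apply wlt_wle in Hx].
    - rewrite <- (Hf _ _ Hx). cbn. rewrite <- comp_assoc.
      f_equal. apply fmap_wle.
    - rewrite <- (Hf _ _ Hx). cbn. rewrite <- comp_assoc.
      f_equal. symmetry; apply fmap_wle. }
  destruct (dep_choice _ _ _ T) as [t Ht]. exists t. split.
  - intros i j h. destruct (cof j) as [x hx].
    rewrite <- (Ht j x hx), <- comp_assoc.
    rewrite <- (Ht i x (wle_trans h hx)).
    exact (f_equal (comp (f x)) (fmap_wle H h hx _)).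
  - intros x. rewrite <- (Ht (e x) x (wle_refl _)).
    etransitivity; [exact (f_equal (comp (f x)) (fmap_wle_refl H _)) | apply comp_idr].
Qed.

Lemma cofinal_cocone {nu mu : WO} {K : Category} (H : Functor (WOcat mu) K)
  (e : wcar nu -> wcar mu) (mon : forall i j, wle i j -> wle (e i) (e j)) S f :
  is_cocone H S f -> is_cocone (Fcomp H (reindex e mon)) S (fun x => f (e x)).
Proof. intros Hf x y h. apply Hf. Qed.

Lemma cofinal_limiting {nu mu : WO} {K : Category} (H : Functor (WOcat mu) K)
  (e : wcar nu -> wcar mu) (mon : forall i j, wle i j -> wle (e i) (e j))
  (cof : forall i, exists x, wle i (e x)) S f :
  is_cocone H S f ->
  (is_limiting H S f <-> is_limiting (Fcomp H (reindex e mon)) S (fun x => f (e x))).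
Proof.
  intros Hf.
  assert (ext : forall X (a b : Hom S X),
    (forall x, a ∘ f (e x) = b ∘ f (e x)) -> forall i, a ∘ f i = b ∘ f i).
  { intros X a b E i. destruct (cof i) as [x h].
    rewrite <- (Hf i (e x) h), !comp_assoc, E; reflexivity. }
  split; intros L.
  - apply limiting_intro.
    + apply cofinal_cocone, Hf.
    + intros S' f' Hf'. destruct (cofinal_extend H e mon cof S' f' Hf') as (g & Hg & Eg).
      destruct (limiting_mediate L S' g Hg) as [m Hm].
      exists m. intros x. cbn. rewrite Hm; apply Eg.
    + intros X a b E. apply (limiting_epi L), ext, E.
  - apply limiting_intro; [exact Hf | |].
    + intros S' f' Hf'.
      destruct (limiting_mediate L S' (fun x => f' (e x)) (cofinal_cocone H e mon S' f' Hf'))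
        as [m Hm].
      exists m. intros i. destruct (cof i) as [x h].
      rewrite <- (Hf i (e x) h), comp_assoc.
      rewrite <- (Hf' i (e x) h). f_equal; apply Hm.
    + intros X a b E. apply (limiting_epi L). intros x; apply E.
Qed.

Definition chain {mu : WO} {K : Category} (Z : wcar mu -> Obj K)
  (m : forall i j, wle i j -> Hom (Z i) (Z j))
  (mid : forall i, m i i (wle_refl i) = idm (Z i))
  (mcomp : forall i j k (f : wle i j) (g : wle j k),
     m i k (wle_trans f g) = m j k g ∘ m i j f) : Functor (WOcat mu) K :=
  Build_Functor (WOcat mu) K Z m mid mcomp.

Definition const_functor (D : Category) {K : Category} (U : Obj K) : Functor D K.
Proof.
  refine {| fobj := fun _ => U; fmap := fun _ _ _ => idm U |};
  intros; [reflexivity | symmetry; apply comp_idl].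
Defined.

(** Cancelling [z] makes factorizations that were chosen separately for each pair of indices
    functorial. With [X] constant at [U], an increasing family of subobjects of [U] becomes a
    chain. *)
Lemma mono_chain {mu : WO} {K : Category} (X : Functor (WOcat mu) K)
  (Z : wcar mu -> Obj K) (z : forall i, Hom (Z i) (fobj X i)) :
  (forall i, is_mono (z i)) ->
  (forall i j (h : @Hom (WOcat mu) i j), exists m, z j ∘ m = fmap X h ∘ z i) ->
  exists m mid mcomp, forall i j (h : @Hom (WOcat mu) i j),
    z j ∘ fmap (chain Z m mid mcomp) h = fmap X h ∘ z i.
Proof.
  intros Mz fac.
  destruct (dep_choice3 _ _ wle (fun i j _ => Hom (Z i) (Z j))
    (fun i j h m => z j ∘ m = fmap X (h : @Hom (WOcat mu) i j) ∘ z i) fac) as [m Hm].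
  assert (mid : forall i, m i i (wle_refl i) = idm (Z i)).
  { intros i. apply (Mz i). rewrite Hm, comp_idr.
    change (wle_refl i) with (@idm (WOcat mu) i). rewrite fmap_id, comp_idl; reflexivity. }
  assert (mcomp : forall i j k (f : wle i j) (g : wle j k),
     m i k (wle_trans f g) = m j k g ∘ m i j f).
  { intros i j k f g. apply (Mz k). rewrite comp_assoc, !Hm, <- comp_assoc, Hm, comp_assoc.
    f_equal. exact (fmap_comp X (f : @Hom (WOcat mu) i j) (g : @Hom (WOcat mu) j k)). }
  exists m, mid, mcomp. intros i j h; exact (Hm i j h).
Qed.

(** [wle] is a disjunction in [Prop] and cannot be eliminated to build a morphism. The transition is
    therefore chosen from a relation that covers both cases, with the identity transported along
    [i = j]. *)
Lemma strict_chain {mu : WO} {K : Category} (Z : wcar mu -> Obj K)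
  (c : forall i j, wlt i j -> Hom (Z i) (Z j)) :
  (forall i j k hij hjk hik, c j k hjk ∘ c i j hij = c i k hik) ->
  exists m mid mcomp, forall i j h h', fmap (chain (mu:=mu) Z m mid mcomp) h = c i j h'.
Proof.
  intros Hc.
  destruct (dep_choice3 _ _ wle (fun i j _ => Hom (Z i) (Z j))
    (fun i j h m => (forall h', m = c i j h') /\
      forall e : i = j, m = eq_rect i (fun j => Hom (Z i) (Z j)) (idm _) j e)) as [m Hm].
  { intros i j [e | h].
    - subst j. exists (idm _). split.
      + intros h'; destruct (wlt_irrefl mu _ h').
      + intros e. rewrite (proof_irrelevance _ e eq_refl). reflexivity.
    - exists (c i j h). split.
      + intros h'. f_equal; apply proof_irrelevance.
      + intros <-. destruct (wlt_irrefl mu _ h). }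
  assert (mid : forall i h, m i i h = idm (Z i)).
  { intros i h. exact (proj2 (Hm i i h) eq_refl). }
  assert (mc : forall i j h h', m i j h = c i j h') by (intros; apply Hm).
  exists m, (fun i => mid i _).
  assert (mcomp : forall i j k (f : wle i j) (g : wle j k),
     m i k (wle_trans f g) = m j k g ∘ m i j f).
  { intros i j k f g. generalize (wle_trans f g); intros h.
    destruct f as [<- | f].
    - rewrite mid, comp_idr. f_equal; apply proof_irrelevance.
    - destruct g as [<- | g].
      + rewrite mid, comp_idl. f_equal; apply proof_irrelevance.
      + rewrite (mc i j _ f), (mc j k _ g), (mc i k _ (wlt_trans mu _ _ _ f g)).
        symmetry; apply Hc. }
  exists mcomp. exact mc.
Qed.
Lemma factor_wle {mu : WO} {K : Category} {H : Functor (WOcat mu) K} {S f} :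
  is_cocone H S f -> forall V (t : Hom V S) (i j : Obj (WOcat mu)), wle i j ->
  (exists g, f i ∘ g = t) -> exists g, f j ∘ g = t.
Proof.
  intros Hf V t i j h [g E]. exists (fmap H (h : @Hom (WOcat mu) i j) ∘ g).
  rewrite comp_assoc, Hf; exact E.
Qed.

Lemma ord_le_refl (l : WO) : ord_le l l.
Proof. exists (fun i => i); auto. Qed.

(** Every piece of [S] factors through some stage of the test chain. There are fewer than [l]
    pieces, so a common stage [b] serves, and the factorizations are compatible because [f' b] is
    monic. *)
Lemma seg_colimit_small {l : WO} (reg : regular_cardinal l) {K : Category}
  (mono : all_mono K) (k : wcar l) (H : Functor (WOcat (seg k)) K) S f :
  (forall i, small l (fobj H i)) -> is_limiting H S f -> small l S.
Proof.
  intros sm L H' S' f' L' h.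
  destruct (seg_eventually reg k
    (fun j hj b => exists g, f' b ∘ g = h ∘ f (exist _ j hj))) as [b Hb].
  - intros j hj b b' Hbb. apply (factor_wle (proj1 L')), Hbb.
  - intros j hj. destruct (sm (exist _ j hj) H' S' f' L' (h ∘ f (exist _ j hj)))
      as (b & g & E). exists b, g. symmetry; exact E.
  - destruct (dep_choice (Obj (WOcat (seg k))) (fun x => Hom (fobj H x) (fobj H' b))
      (fun x g => f' b ∘ g = h ∘ f x)) as [g Hg].
    { intros [j hj]; apply Hb. }
    destruct (limiting_mediate L _ g) as [m Hm].
    { intros x y e. apply (mono _ _ (f' b)). rewrite comp_assoc, !Hg, <- comp_assoc.
      f_equal; apply L. }
    exists b, m. apply (limiting_epi L). intros x.
    rewrite <- comp_assoc, Hm, Hg; reflexivity.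
Qed.

(* Each X i is the colimit of a chain of small objects Y i j. By smallness the
   pieces Y i' j with i', j < i factor through one Y i (k i), so that the
   diagonal i |-> Y i (k i) is a chain of small objects having the same
   cocones as X. *)
Lemma chain_colimit {l : WO} (reg : regular_cardinal l) {K : Category}
  (mono : all_mono K) (alg : semi_algebroidal l K) (X : Functor (WOcat l) K) :
  exists S f, is_limiting X S f.
Proof.
  destruct (dep_choice (wcar l) (fun _ => Functor (WOcat l) K)
    (fun i H => (forall j, small l (fobj H j)) /\
       exists f : forall j, Hom (fobj H j) (fobj X i), is_limiting H (fobj X i) f))
    as [Y HY].
  { intros i; apply alg. }
  assert (smY : forall i j, small l (fobj (Y i) j)) by apply HY.
  destruct (dep_choice (wcar l) (fun i => forall j, Hom (fobj (Y i) j) (fobj X i))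
    (fun i f => is_limiting (Y i) (fobj X i) f)) as [y Ly].
  { apply HY. }
  clear HY.
  (* The condition is vacuous unless [i'] is at most [i], so [fac] can be handled without order
     hypotheses. *)
  pose (fac := fun i' j i k => forall h : wle i' i, exists m,
    y i k ∘ m = fmap X (h : @Hom (WOcat l) i' i) ∘ y i' j).
  assert (fac_wle : forall i' j i k k', wle k k' -> fac i' j i k -> fac i' j i k').
  { intros i' j i k k' Hk F h. exact (factor_wle (proj1 (Ly i)) _ _ _ _ Hk (F h)). }
  assert (fac_ex : forall i' j i, exists k, fac i' j i k).
  { intros i' j i. destruct (classic (wle i' i)) as [h | h].
    - destruct (smY i' j (Y i) _ _ (Ly i) (fmap X (h : @Hom (WOcat l) i' i) ∘ y i' j))
        as (k & m & E). exists k. intros h'.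
      exists m. rewrite (proof_irrelevance _ h' h). symmetry; exact E.
    - exists i. intros h'; contradiction. }
  destruct (wf_dep_choice (wcar l) wlt (wlt_wf l) (fun _ => wcar l)
    (fun i h x => forall i' (h1 : wlt i' i),
       fac i' (h i' h1) i x /\ forall j, wlt j i -> fac i' j i x)) as [k Hk].
  { intros _; apply reg. }
  { intros i h _.
    apply (seg_eventually reg i
      (fun i' h1 x => fac i' (h i') i x /\ forall j, wlt j i -> fac i' j i x)).
    - intros i' h1 b b' Hb [F1 F2]. split; [| intros j hj; specialize (F2 j hj)]; eauto.
    - intros i' h1. destruct (fac_ex i' (h i') i) as [b1 F1].
      destruct (seg_eventually reg i (fun j _ x => fac i' j i x)) as [b2 F2]; eauto.
      destruct (upper_bound2 b1 b2) as (b & B1 & B2). exists b. split; eauto. }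
  destruct (mono_chain X (fun i => fobj (Y i) (k i)) (fun i => y i (k i)))
    as (m & mid & mcomp & nat).
  { intros i; apply mono. }
  { intros i j h. destruct (id h) as [<- | h'].
    - exists (idm _). rewrite comp_idr. symmetry.
      etransitivity; [| apply comp_idl]. f_equal. apply (fmap_wle_refl X).
    - exact (proj1 (Hk j i h') h). }
  assert (nat' : forall i j (h : wle i j),
    y j (k j) ∘ m i j h = fmap X (h : @Hom (WOcat l) i j) ∘ y i (k i)) by exact nat.
  clear nat.
  (* Any [n] strictly above [i] and [j] works: [k n] was chosen so that all pieces with both indices
     below [n] factor. *)
  assert (reach : forall i j, exists n, wle i n /\ forall i', wle i' i -> fac i' j n (k n)).
  { intros i j. destruct (upper_bound2 i j) as (n0 & A1 & A2).
    destruct (regular_succ reg n0) as [n A3]. exists n. split.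
    - exact (wlt_wle _ _ (wle_lt_trans _ _ _ A1 A3)).
    - intros i' A4. apply (Hk n i').
      + exact (wle_lt_trans _ _ _ A4 (wle_lt_trans _ _ _ A1 A3)).
      + exact (wle_lt_trans _ _ _ A2 A3). }
  (* The crux: a cocone on the diagonal extends to [X]. On [Y i j] it is [s' n ∘ g] for any
     factorization [g] through a diagonal term; monic legs make this independent of [n] and [g], and
     the values glue along the colimit of [Y i]. *)
  assert (ext : forall S' (s' : forall i, Hom (fobj (Y i) (k i)) S'),
    (forall i j h, s' j ∘ m i j h = s' i) ->
    exists t, is_cocone X S' t /\ forall i, t i ∘ y i (k i) = s' i).
  { intros S' s' Hs.
    assert (W : forall i j, exists w : Hom (fobj (Y i) j) S',
      forall n (h : wle i n) g, y n (k n) ∘ g = fmap X (h : @Hom (WOcat l) i n) ∘ y i j ->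
      s' n ∘ g = w).
    { intros i j. destruct (reach i j) as (n0 & h0 & F).
      destruct (F i (wle_refl i) h0) as [g0 E0]. exists (s' n0 ∘ g0).
      intros n h g E.
      destruct (wle_lt_dec n n0) as [Hn | Hn]; [| apply wlt_wle in Hn].
      - rewrite <- (Hs n n0 Hn), <- comp_assoc. f_equal. apply (mono _ _ (y n0 (k n0))).
        rewrite comp_assoc, nat', <- comp_assoc, E, comp_assoc.
        etransitivity; [| symmetry; apply E0]. f_equal. apply fmap_wle.
      - rewrite <- (Hs n0 n Hn), <- comp_assoc. f_equal. apply (mono _ _ (y n (k n))).
        rewrite (comp_assoc g0), nat', <- comp_assoc.
        etransitivity; [apply E |].
        etransitivity; [| symmetry; exact (f_equal (comp _) E0)].
        rewrite comp_assoc. f_equal. symmetry; apply fmap_wle. }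
    destruct (dep_choice3 (wcar l) (wcar l) (fun _ _ => True)
      (fun i j _ => Hom (fobj (Y i) j) S') (fun i j _ w =>
      forall n (h : wle i n) g, y n (k n) ∘ g = fmap X (h : @Hom (WOcat l) i n) ∘ y i j ->
      s' n ∘ g = w)) as [w Hw].
    { intros i j _; apply W. }
    destruct (dep_choice (Obj (WOcat l)) (fun i => Hom (fobj X i) S')
      (fun i t => forall j, t ∘ y i j = w i j I)) as [t Ht].
    { intros i. apply (limiting_mediate (Ly i)).
      intros j j' hj. destruct (reach i j') as (n & h & F).
      destruct (F i (wle_refl i) h) as [g E].
      rewrite <- (Hw i j' I n h g E), <- comp_assoc. apply (Hw i j I n h).
      rewrite comp_assoc. etransitivity; [exact (f_equal (fun q => q ∘ _) E) |].
      rewrite <- comp_assoc. f_equal. apply Ly. }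
    exists t. split.
    - intros i i' h. apply (limiting_epi (Ly i)). intros j. rewrite Ht, <- comp_assoc.
      destruct (smY i j (Y i') _ _ (Ly i') (fmap X h ∘ y i j)) as (j' & g & E).
      rewrite E, comp_assoc, Ht.
      destruct (reach i' j') as (n & hn & F).
      destruct (F i' (wle_refl i') hn) as [q Eq].
      rewrite <- (Hw i' j' I n hn q Eq), <- comp_assoc.
      apply (Hw i j I n (wle_trans h hn)).
      rewrite comp_assoc. etransitivity; [exact (f_equal (fun q => q ∘ _) Eq) |].
      rewrite <- comp_assoc, <- E, comp_assoc. f_equal. apply fmap_wle.
    - intros i. rewrite (Ht i (k i)).
      rewrite <- (Hw i (k i) I i (wle_refl i) (idm _)); [apply comp_idr |].
      rewrite comp_idr. symmetry. etransitivity; [| apply comp_idl]. f_equal.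
      apply (fmap_wle_refl X). }
  destruct (proj1 alg l (ord_le_refl l) (chain _ m mid mcomp)) as (S & s & Ls).
  { intros i; apply (smY i). }
  destruct (ext S s (proj1 Ls)) as (f & Cf & Ef).
  exists S, f. apply limiting_intro; [exact Cf | |].
  - intros S' f' Cf'. destruct (limiting_mediate Ls S' (fun i => f' i ∘ y i (k i))) as [q Hq].
    { intros i j h. change (f' j ∘ y j (k j) ∘ m i j h = f' i ∘ y i (k i)).
      rewrite <- comp_assoc, nat', comp_assoc, Cf'; reflexivity. }
    assert (Hq' : forall i, q ∘ (f i ∘ y i (k i)) = f' i ∘ y i (k i)).
    { intros i. rewrite Ef; exact (Hq i). }
    exists q. intros i. apply (limiting_epi (Ly i)). intros j.
    destruct (reach i j) as (n & h & F). destruct (F i (wle_refl i) h) as [g E].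
    rewrite <- (Cf i n h), <- (Cf' i n h), <- !comp_assoc.
    rewrite <- E, !comp_assoc, <- (comp_assoc _ _ q). rewrite Hq'; reflexivity.
  - intros V a b E. apply (limiting_epi Ls). intros i.
    etransitivity; [exact (f_equal (comp a) (eq_sym (Ef i))) |].
    etransitivity; [| exact (f_equal (comp b) (Ef i))].
    rewrite !comp_assoc, E; reflexivity.
Qed.

(** The empty chain has a colimit, which provides some object; writing it as the colimit of a chain
    along the nonempty [l] provides small ones. *)
Lemma small_inhabited {l : WO} {K : Category} :
  regular_cardinal l -> semi_algebroidal l K -> inhabited (Obj (SmallSub l K)).
Proof.
  intros [[i] _] [ch dec].
  pose (E := {| wcar := Empty_set; wlt := fun _ _ => False;
    wlt_irrefl := fun x => match x with end; wlt_trans := fun x => match x with end;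
    wlt_total := fun x => match x with end; wlt_wf := fun x => match x with end |}).
  assert (H : inhabited (Functor (WOcat E) K)).
  { constructor. unshelve refine (Build_Functor (WOcat E) K _ _ _ _); intros []. }
  destruct H as [H]. destruct (ch E) with (H := H) as [S _].
  - exists (fun x : Empty_set => match x with end). intros [].
  - intros [].
  - destruct (dec S) as (H' & sm & _). constructor. exists (fobj H' i). apply sm.
Qed.
(** * Universal homogeneous objects of algebroidal categories *)

Definition into {K : Category} {X V : Obj K} (m : Hom V X) : {V : Obj K & Hom V X} :=
  existT (fun V => Hom V X) V m.

Lemma into_injective {K : Category} {X V : Obj K} : injective (@into K X V).
Proof. intros m m' E. exact (inj_pair2 _ (fun V => Hom V X) _ _ _ E). Qed.

(* A stage records its object X together with, for every index j, an arrow into X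
   with unconstrained domain V: that V is the object of stage j is part of the
   relation P, which keeps the recursion non-dependent. *)
Lemma chain_construction {l : WO} {K : Category} (inh : inhabited (Obj K))
  (Q : wcar l -> wcar l -> forall V X : Obj K, Hom V X -> Prop) :
  (forall i (D : Functor (WOcat (seg i)) K),
     exists X (c : forall x, Hom (fobj D x) X), is_cocone D X c /\
       forall x : wcar (seg i), Q i (proj1_sig x) _ _ (c x)) ->
  exists U : Functor (WOcat l) K, forall (i j : Obj (WOcat l)) (h : Hom j i),
    @wlt l j i -> Q i j _ _ (fmap U h).
Proof.
  intros step.
  pose (T := {X : Obj K & wcar l -> {V : Obj K & Hom V X}}).
  pose (P := fun i (h : forall j, wlt j i -> T) (x : T) =>
    exists c : forall j hj, Hom (projT1 (h j hj)) (projT1 x),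
      (forall j hj, projT2 x j = into (c j hj)) /\
      (forall j k hj hk (hkj : wlt k j) (m : Hom (projT1 (h k hk)) (projT1 (h j hj))),
         projT2 (h j hj) k = into m -> c j hj ∘ m = c k hk) /\
      (forall j hj, Q i j _ _ (c j hj))).
  destruct (wf_dep_choice (wcar l) wlt (wlt_wf l) (fun _ => T) P) as [f Hf].
  - intros _. destruct inh as [X]. constructor. exists X. intros _. exists X. exact (idm X).
  - intros i h IH.
    destruct (dep_choice (wcar (seg i)) (fun x => forall k, wlt k (proj1_sig x) ->
        Hom (projT1 (h k)) (projT1 (h (proj1_sig x)))) (fun x c =>
        (forall k hk, projT2 (h (proj1_sig x)) k = into (c k hk)) /\
        (forall j k hj hk (hkj : wlt k j) (m : Hom (projT1 (h k)) (projT1 (h j))),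
           projT2 (h j) k = into m -> c j hj ∘ m = c k hk))) as [a Ha].
    { intros [j hj]. destruct (IH j hj) as (c & E1 & E2 & _). exists c. split; assumption. }
    destruct (strict_chain (mu := seg i) (fun x => projT1 (h (proj1_sig x)))
      (fun x y hxy => a y (proj1_sig x) hxy)) as (m & mid & mcomp & Em).
    { intros x y z hxy hyz hxz. apply (proj2 (Ha z)); [exact hxy |]. apply Ha. }
    destruct (step i (chain _ m mid mcomp)) as (X & s & Cs & HQ).
    destruct (dep_choice (wcar l) (fun _ => {V : Obj K & Hom V X})
      (fun j v => forall hj,
         v = into (s (exist (fun j => wlt j i) j hj) : Hom (projT1 (h j)) X))) as [b Hb].
    { intros j. destruct (classic (wlt j i)) as [hj | hj].
      - eexists. intros hj'. rewrite (proof_irrelevance _ hj' hj). reflexivity.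
      - exists (into (idm X)). intros hj'; contradiction. }
    exists (existT _ X b). exists (fun j hj => s (exist (fun j => wlt j i) j hj)). cbn.
    split; [| split].
    + intros j hj; apply Hb.
    + intros j k hj hk hkj g Hg.
      pose (x := exist (fun j => wlt j i) j hj : wcar (seg i)).
      pose (y := exist (fun j => wlt j i) k hk : wcar (seg i)).
      assert (g = a x k hkj) as ->.
      { apply into_injective. rewrite <- Hg. exact (proj1 (Ha x) k hkj). }
      etransitivity; [| exact (Cs y x (wlt_wle (l := seg i) y x hkj))].
      exact (f_equal (comp (s x)) (eq_sym (Em y x _ hkj))).
    + intros j hj. apply (HQ (exist (fun j => wlt j i) j hj)).
  - destruct (dep_choice (wcar l) (fun i => forall j, wlt j i -> Hom (projT1 (f j)) (projT1 (f i)))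
      (fun i c => (forall j hj, projT2 (f i) j = into (c j hj)) /\
      (forall j k hj hk (hkj : wlt k j) (m : Hom (projT1 (f k)) (projT1 (f j))),
         projT2 (f j) k = into m -> c j hj ∘ m = c k hk) /\
      (forall j hj, Q i j _ _ (c j hj)))) as [c Hc]; [exact Hf |].
    destruct (strict_chain (fun i => projT1 (f i)) (fun i j hij => c j i hij))
      as (m & mid & mcomp & Em).
    { intros i j k hij hjk hik. apply Hc; [exact hij |]. apply Hc. }
    exists (chain _ m mid mcomp). intros i j h h'. rewrite (Em j i h h'). apply Hc.
Qed.

(** Coding triples and forgetting the last entry makes each pair recur at unboundedly many indices,
    so a task about stage [j] comes up after [j]. *)
Lemma bookkeeping {l : WO} (reg : regular_cardinal l) :
  exists task : wcar l -> wcar l * wcar l,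
    forall j a, exists i, wlt j i /\ task i = (j, a).
Proof.
  destruct (pairing reg) as [p Hp].
  pose (e := fun q : (wcar l * wcar l) * wcar l => p (p (fst q), snd q)).
  assert (He : injective e).
  { intros [q b] [q' b'] E. apply Hp in E. injection E as E ->.
    apply Hp in E. cbn in E; subst; reflexivity. }
  destruct (proj1 reg) as [i0].
  destruct (injective_surj e (inhabits (i0, i0, i0)) He) as [s Hs].
  exists (fun i => fst (s i)). intros j a.
  destruct (injective_unbounded reg (fun b => e (j, a, b))) with (k := j)
    as [b Hb].
  { intros b b' E. apply He in E. congruence. }
  exists (e (j, a, b)). split; [exact Hb | rewrite Hs; reflexivity].
Qed.

(** Injectivity of [U] with respect to morphisms between small objects: the extension property
    behind both universality and homogeneity. *)
Definition saturated (l : WO) {K : Category} (U : Obj K) : Prop :=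
  forall X Y : Obj K, small l X -> small l Y ->
  forall (p : Hom X U) (t : Hom X Y), exists r : Hom Y U, r ∘ t = p.

Section FraisseLimit.
Context {l : WO} (reg : regular_cardinal l) {K : Category}.
Context (alg : algebroidal l K) (mono : all_mono K).

Lemma representatives :
  exists (code : Obj (SmallSub l K) -> wcar l) (R : wcar l -> Obj (SmallSub l K)),
    forall Y, isomorphic Y (R (code Y)).
Proof.
  destruct alg as [semi [[code Hcode] _]].
  destruct (dep_choice (wcar l) (fun _ => Obj (SmallSub l K))
    (fun c R => forall Y, code Y = c -> isomorphic Y R)) as [R HR].
  { intros c. destruct (classic (exists Z, code Z = c)) as [[Z <-] | N].
    - exists Z. intros Y E. apply Hcode, E.
    (* A code that is not attained still needs a value; any small object will do. *)
    - destruct (small_inhabited reg semi) as [V].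
      exists V. intros Y E. destruct N; eauto. }
  exists code, R. intros Y. exact (HR _ Y eq_refl).
Qed.

(** A morphism from [V] into a representative is coded by the code of its target together with its
    index in the hom-set, hence by an element of [l]. A morphism into an arbitrary small [Y] reaches
    the list after composing with an isomorphism from [Y] to its representative. *)
Lemma dominating_family (V : Obj (SmallSub l K)) :
  exists fam : wcar l -> {Y : Obj (SmallSub l K) & Hom V Y},
    forall Y (e : Hom V Y), exists a (m : Hom Y (projT1 (fam a))), m ∘ e = projT2 (fam a).
Proof.
  destruct representatives as (code & R & HR). destruct (pairing reg) as [p Hp].
  destruct (dep_choice (wcar l) (fun c => @Hom (SmallSub l K) V (R c) -> wcar l)
    (fun c e => injective e)) as [h Hh].
  { intros c. exact (proj2 (proj2 alg) _ _ (proj2_sig V) (proj2_sig (R c))). }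
  pose (e := fun x : {c : wcar l & @Hom (SmallSub l K) V (R c)} =>
    p (projT1 x, h _ (projT2 x))).
  assert (He : injective e).
  { intros [c f] [c' f'] E. apply Hp in E. cbn in E. injection E as E1 E2.
    subst c'. apply Hh in E2. subst; reflexivity. }
  assert (Rep : forall Y, exists c (m : @Hom (SmallSub l K) Y (R c)), True).
  { intros Y. destruct (HR Y) as [m _]. eauto. }
  destruct (injective_surj e) as [s Hs]; [| exact He |].
  { destruct (Rep V) as (c & m & _). exact (inhabits (existT _ c m)). }
  exists (fun a => existT _ (R (projT1 (s a))) (projT2 (s a))).
  intros Y f. destruct (Rep Y) as (c & m & _).
  exists (e (existT _ c (m ∘ f))). cbn [projT1 projT2]. rewrite Hs. exists m. reflexivity.
Qed.

(** At stage [i] the task [(j, a)] is fulfilled by amalgamating the [a]-th listed morphism out of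
    stage [j] with the colimit of the earlier stages. Only morphisms out of stages are listed; an
    extension problem along [t] is reduced to one by factoring [p] through a stage as [q] and
    amalgamating [t] with [q]. *)
Lemma saturated_exists : ap (SmallSub l K) -> exists U : Obj K, saturated l U.
Proof.
  intros AP. destruct (bookkeeping reg) as [task Htask].
  destruct (dep_choice (Obj (SmallSub l K))
    (fun V => wcar l -> {Y : Obj (SmallSub l K) & Hom V Y}) _ dominating_family)
    as [fam Hfam].
  destruct (chain_construction (l := l) (small_inhabited reg (proj1 alg))
    (fun i j V X c => fst (task i) = j ->
       exists g : Hom (projT1 (fam V (snd (task i)))) X,
         g ∘ projT2 (fam V (snd (task i))) = c)) as [U HU].
  - intros i D.
    destruct (proj1 (proj1 alg) (seg i) (seg_ord_le i) (Fcomp (Incl K _) D))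
      as (S & s & L).
    { intros x. exact (proj2_sig (fobj D x)). }
    assert (sm : small l S).
    { refine (seg_colimit_small reg mono i _ S s _ L). intros x. exact (proj2_sig (fobj D x)). }
    destruct (classic (wlt (fst (task i)) i)) as [hj | hj].
    + pose (x := exist _ (fst (task i)) hj : Obj (WOcat (seg i))).
      destruct (AP (fobj D x) (projT1 (fam (fobj D x) (snd (task i)))) (exist _ S sm)
        (projT2 (fam (fobj D x) (snd (task i)))) (s x)) as (X & f' & g' & E).
      exists X, (fun y => f' ∘ (s y : @Hom (SmallSub l K) (fobj D y) (exist _ S sm))).
      split.
      * intros y z h. rewrite <- comp_assoc. f_equal. apply (proj1 L).
      * intros [j hj'] Ej. cbn in Ej. subst j.
        rewrite (proof_irrelevance _ hj' hj). exists g'. exact E.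
    (* A task about a stage not yet built asks for nothing, and the colimit itself becomes the next
       stage. *)
    + exists (exist _ S sm), s. split; [exact (proj1 L) |].
      intros [j hj'] Ej. cbn in Ej. subst j. contradiction.
  - destruct (proj1 (proj1 alg) l (ord_le_refl l) (Fcomp (Incl K _) U)) as (S & u & L).
    { intros i. exact (proj2_sig (fobj U i)). }
    exists S. intros X Y sX sY p t.
    destruct (sX _ S u L p) as (j & q & Ep).
    destruct (AP (exist _ X sX) (exist _ Y sY) (fobj U j) t q) as (W & e & w & Ew).
    destruct (Hfam (fobj U j) W e) as (a & m & Em).
    destruct (Htask j a) as (i & Hji & Et).
    specialize (HU i j (wlt_wle _ _ Hji) Hji). cbv beta in HU. rewrite Et in HU.
    destruct (HU eq_refl) as [g Eg]. cbn [snd] in g, Eg.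
    assert (key : g ∘ m ∘ w ∘ (t : @Hom (SmallSub l K) (exist _ X sX) (exist _ Y sY))
      = fmap U (wlt_wle _ _ Hji : @Hom (WOcat l) j i)
        ∘ (q : @Hom (SmallSub l K) (exist _ X sX) (fobj U j))).
    { rewrite <- Eg, <- Em, <- !comp_assoc, Ew. reflexivity. }
    exists (u i ∘ (g ∘ m ∘ w : @Hom K Y (proj1_sig (fobj U i)))).
    rewrite Ep, <- (proj1 L j i (wlt_wle _ _ Hji)).
    etransitivity; [symmetry; apply comp_assoc |].
    etransitivity; [exact (f_equal (comp (u i)) key) |].
    exact (@comp_assoc K _ _ _ _ q (fmap (Fcomp (Incl K _) U)
      (wlt_wle _ _ Hji : @Hom (WOcat l) j i)) (u i)).
Qed.

(** [V] is mapped stage by stage along a chain [X] of small objects. [X] need not be continuous, so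
    the earlier morphisms are gathered on the colimit [S] of the part below [i] and then extended
    along the comparison from [S] to stage [i]. *)
Lemma saturated_universal (U : Obj K) :
  jep (SmallSub l K) -> saturated l U -> universal_for (fun _ => True) U.
Proof.
  intros JEP sat V _.
  destruct (proj2 (proj1 alg) U) as (HU & smU & u & LU).
  destruct (proj2 (proj1 alg) V) as (X & smX & x & LX).
  (* Joint embedding with a stage of [U], followed by saturation, gives the inhabitant that the
     choice by [epsilon] asks for. *)
  assert (some : forall i, inhabited (Hom (fobj X i) U)).
  { intros i. destruct (JEP (exist _ _ (smX i)) (exist _ _ (smU i))) as ([D sD] & f & g & _).
    destruct (sat (fobj HU i) D (smU i) sD (u i) g) as [r _].
    constructor. exact (r ∘ (f : Hom (fobj X i) D)). }
  destruct (wf_dep_choice (wcar l) wlt (wlt_wf l) (fun i => Hom (fobj X i) U)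
    (fun i h c => forall j (hj : wlt j i) (hj' : @Hom (WOcat l) j i),
       c ∘ fmap X hj' = h j hj)) as [f Hf]; [exact some | |].
  - intros i h IH.
    pose (emb := reindex (nu := seg i) (mu := l) (@proj1_sig _ _) (seg_wle i)).
    destruct (proj1 (proj1 alg) (seg i) (seg_ord_le i) (Fcomp X emb)) as (S & s & L).
    { intros j; apply smX. }
    assert (sS : small l S).
    { refine (seg_colimit_small reg mono i _ S s _ L). intros j; apply smX. }
    destruct (limiting_mediate L U (fun j => h (proj1_sig j))) as [p Hp].
    { intros j k [<- | hjk].
      - etransitivity; [| apply comp_idr]. f_equal. apply (fmap_wle_refl (Fcomp X emb)).
      - exact (IH _ (proj2_sig k) _ hjk _). }
    destruct (limiting_mediate L (fobj X i)
      (fun j => fmap X (wlt_wle _ _ (proj2_sig j) : @Hom (WOcat l) _ i))) as [t Ht].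
    { intros j k hjk. exact (fmap_wle X (seg_wle i j k hjk) _ _). }
    destruct (sat S (fobj X i) sS (smX i) p t) as [r Hr].
    exists r. intros j hj hj'.
    etransitivity; [| exact (Hp (exist _ j hj))].
    rewrite <- Hr, <- comp_assoc. f_equal.
    etransitivity; [| symmetry; exact (Ht (exist _ j hj))].
    f_equal. apply (proof_irrelevance (wle _ _)).
  - destruct (limiting_mediate LX U f) as [m _]; [| exists m; exact I].
    intros j i hji. destruct (id hji) as [<- | hj]; [| apply (Hf i j hj)].
    etransitivity; [| apply comp_idr]. f_equal. apply (fmap_wle_refl X).
Qed.

(* Back and forth: a pair of morphisms X -> U with X small is extended along a
   chain of length l until both legs cover U. *)
Lemma saturated_homogeneous (U : Obj K) :
  saturated l U -> homogeneous_for (small l) U.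
Proof.
  intros sat A sA f g.
  destruct (proj2 (proj1 alg) U) as (H & smH & u & LU).
  pose (T := {X : Obj (SmallSub l K) & (Hom (proj1_sig X) U * Hom (proj1_sig X) U)%type}).
  pose (R := fun x y : T => exists m : Hom (proj1_sig (projT1 x)) (proj1_sig (projT1 y)),
    fst (projT2 y) ∘ m = fst (projT2 x) /\ snd (projT2 y) ∘ m = snd (projT2 x)).
  assert (Rtrans : forall x y z, R x y -> R y z -> R x z).
  { intros x y z [m [E1 E2]] [n [E3 E4]]. exists (n ∘ m).
    rewrite !comp_assoc, E3, E4. auto. }
  assert (Rrefl : forall x, R x x).
  { intros x. exists (idm _). rewrite !comp_idr; auto. }
  pose (t0 := existT _ (exist _ A sA) (f, g) : T).
  (* The first leg factors through [fobj H k] with [k] at or above [i]. This object replaces [X]: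
     its first leg is [u k], which covers [u i], and its second leg extends [q] by saturation. *)
  assert (cov1 : forall x i, exists y, R x y /\ exists n, fst (projT2 y) ∘ n = u i).
  { intros [[X sX] [p q]] i. destruct (sX H U u LU p) as (j & t & E).
    destruct (upper_bound2 i j) as (k & hi & hj).
    destruct (factor_wle (proj1 LU) _ _ j k hj (ex_intro _ t (eq_sym E))) as [t' E'].
    destruct (sat X (fobj H k) sX (smH k) q t') as [r Er].
    exists (existT _ (exist _ _ (smH k)) (u k, r)). split.
    - exists t'. auto.
    - exists (fmap H (hi : @Hom (WOcat l) i k)). apply (proj1 LU). }
  assert (cov2 : forall x i, exists y, R x y /\ exists n, snd (projT2 y) ∘ n = u i).
  { intros [X [p q]] i. destruct (cov1 (existT _ X (q, p)) i)
      as ([Y [p' q']] & [m [E1 E2]] & n & En).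
    exists (existT _ Y (q', p')). split; [exists m; auto | exists n; exact En]. }
  assert (seg_bound : forall i (h : wcar l -> T),
    (forall j k, wlt j k -> wlt k i -> R (h j) (h k)) ->
    exists y, forall j, wlt j i -> R (h j) y).
  { intros i h Hh.
    destruct (mono_chain (const_functor (WOcat (seg i)) U)
      (fun j => proj1_sig (projT1 (h (proj1_sig j))))
      (fun j => fst (projT2 (h (proj1_sig j))))) as (m & mid & mcomp & nat).
    { intros j; apply mono. }
    { intros j k [<- | hjk].
      - exists (idm _). rewrite comp_idr. symmetry; apply comp_idl.
      - destruct (Hh _ _ hjk (proj2_sig k)) as [m [E _]]. exists m.
        etransitivity; [exact E | symmetry; apply comp_idl]. }
    destruct (proj1 (proj1 alg) (seg i) (seg_ord_le i) (chain _ m mid mcomp))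
      as (S & s & L).
    { intros j. apply (proj2_sig (projT1 (h (proj1_sig j)))). }
    assert (sS : small l S).
    { refine (seg_colimit_small reg mono i _ S s _ L).
      intros j. apply (proj2_sig (projT1 (h (proj1_sig j)))). }
    destruct (limiting_mediate L U (fun j => fst (projT2 (h (proj1_sig j))))) as [p Hp].
    { intros j k hjk. etransitivity; [apply nat | apply comp_idl]. }
    destruct (limiting_mediate L U (fun j => snd (projT2 (h (proj1_sig j))))) as [q Hq].
    (* The transitions were built from the first legs alone. The second legs respect them as well:
       the first leg is monic, so the transition equals the morphism that witnesses [R]. *)
    { intros j k hjk. destruct (id hjk) as [<- | hjk'].
      - etransitivity; [| apply comp_idr]. f_equal.
        rewrite (proof_irrelevance (wle j j) hjk (wle_refl j)). apply mid.
      - destruct (Hh _ _ hjk' (proj2_sig k)) as [n [E1 E2]].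
        etransitivity; [| exact E2]. f_equal.
        apply (mono _ _ (fst (projT2 (h (proj1_sig k))))).
        etransitivity; [| symmetry; exact E1].
        etransitivity; [apply nat | apply comp_idl]. }
    exists (existT _ (exist _ S sS) (p, q)). intros j hj.
    exists (s (exist _ j hj)). split; [apply (Hp (exist _ j hj)) | apply (Hq (exist _ j hj))]. }
  destruct (wf_dep_choice (wcar l) wlt (wlt_wf l) (fun _ => T) (fun i h x =>
    (forall j (hj : wlt j i), R (h j hj) x) /\ R t0 x /\
    (exists n, fst (projT2 x) ∘ n = u i) /\ (exists n, snd (projT2 x) ∘ n = u i)))
    as [t Ht].
  - intros _; exact (inhabits t0).
  - intros i h IH.
    assert (B : exists y, (forall j, wlt j i -> R (h j) y) /\ R t0 y).
    { destruct (classic (exists j, wlt j i)) as [[j hj] | N].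
      - destruct (seg_bound i h) as [y Hy].
        { intros j' k hj' hk. exact (proj1 (IH k hk) j' hj'). }
        exists y. split; [exact Hy |].
        apply (Rtrans _ (h j)); [apply (IH j hj) | apply Hy, hj].
      (* The least index has no earlier stage from which to inherit [R t0], so the construction
         starts at [t0] itself. *)
      - exists t0. split; [| apply Rrefl]. intros j hj. destruct N; eauto. }
    destruct B as (y & Hy & Hy0).
    destruct (cov1 y i) as (y1 & R1 & n1 & E1).
    destruct (cov2 y1 i) as (y2 & R2 & E2).
    exists y2. split; [| split; [| split; [| exact E2]]]; eauto.
    destruct R2 as [m [Em _]]. exists (m ∘ n1). rewrite comp_assoc, Em; exact E1.
  - destruct (mono_chain (const_functor (WOcat l) U)
      (fun j => proj1_sig (projT1 (t j))) (fun j => fst (projT2 (t j))))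
      as (m & mid & mcomp & nat).
    { intros j; apply mono. }
    { intros j k [<- | hjk].
      - exists (idm _). rewrite comp_idr. symmetry; apply comp_idl.
      - destruct (proj1 (Ht k) j hjk) as [m [E _]]. exists m.
        etransitivity; [exact E | symmetry; apply comp_idl]. }
    destruct (proj1 (proj1 alg) l (ord_le_refl l) (chain _ m mid mcomp)) as (S & s & L).
    { intros j. apply (proj2_sig (projT1 (t j))). }
    destruct (limiting_mediate L U (fun j => fst (projT2 (t j)))) as [p Hp].
    { intros j k hjk. etransitivity; [apply nat | apply comp_idl]. }
    destruct (limiting_mediate L U (fun j => snd (projT2 (t j)))) as [q Hq].
    { intros j k hjk. destruct (id hjk) as [<- | hjk'].
      - etransitivity; [| apply comp_idr]. f_equal.
        rewrite (proof_irrelevance (wle j j) hjk (wle_refl j)). apply mid.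
      - destruct (proj1 (Ht k) j hjk') as [n [E1 E2]].
        etransitivity; [| exact E2]. f_equal.
        apply (mono _ _ (fst (projT2 (t k)))).
        etransitivity; [| symmetry; exact E1].
        etransitivity; [apply nat | apply comp_idl]. }
    (* Stage [i] covers [u i] with both legs, so [p] and [q] are isomorphisms and [q ∘ p'] is the
       automorphism sought. *)
    destruct (covering_iso LU S p) as [p' [P1 P2]]; [apply mono | |].
    { intros i. destruct (Ht i) as (_ & _ & [n En] & _). exists (s i ∘ n).
      rewrite comp_assoc. etransitivity; [exact (f_equal (fun r => r ∘ n) (Hp i)) | exact En]. }
    destruct (covering_iso LU S q) as [q' [Q1 Q2]]; [apply mono | |].
    { intros i. destruct (Ht i) as (_ & _ & _ & [n En]). exists (s i ∘ n).
      rewrite comp_assoc. etransitivity; [exact (f_equal (fun r => r ∘ n) (Hq i)) | exact En]. }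
    destruct (proj1 reg) as [i0].
    destruct (Ht i0) as (_ & [n [E1 E2]] & _). cbn in n, E1, E2.
    exists (q ∘ p'). split.
    + exists (p ∘ q'). split.
      * rewrite comp_assoc, <- (comp_assoc q), Q1, comp_idr; exact P2.
      * rewrite comp_assoc, <- (comp_assoc p), P1, comp_idr; exact Q2.
    + assert (F1 : f = p ∘ (s i0 ∘ n)).
      { rewrite <- E1, comp_assoc. f_equal. symmetry. apply (Hp i0). }
      assert (F2 : g = q ∘ (s i0 ∘ n)).
      { rewrite <- E2, comp_assoc. f_equal. symmetry. apply (Hq i0). }
      rewrite F1, F2, comp_assoc, <- (comp_assoc p), P1, comp_idr. reflexivity.
Qed.

End FraisseLimit.

(** For necessity, small objects mapped to [U] factor through one stage of a chain of small objects
    with colimit [U]. This alone gives joint embedding; for amalgamation, homogeneity first makes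
    the two composites from the common source agree, and the monic [u j] is then cancelled. *)
Theorem droste_goebel {l : WO} {K : Category} :
  regular_cardinal l -> algebroidal l K -> all_mono K ->
  (exists U : Obj K, universal_for (fun _ => True) U /\ homogeneous_for (@small l K) U) <->
  jep (SmallSub l K) /\ ap (SmallSub l K).
Proof.
  intros reg alg mono. split.
  - intros (U & univ & homog).
    destruct (proj2 (proj1 alg) U) as (H & smH & u & L).
    assert (cospan : forall X Y (sX : small l X) (sY : small l Y) (p : Hom X U) (q : Hom Y U),
      exists j f g, u j ∘ f = p /\ u j ∘ g = q).
    { intros X Y sX sY p q.
      destruct (sX H U u L p) as (i & f & Ef). destruct (sY H U u L q) as (j & g & Eg).
      destruct (upper_bound2 i j) as (k & hi & hj).
      destruct (factor_wle (proj1 L) _ _ i k hi (ex_intro _ f (eq_sym Ef))) as [f' Ef'].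
      destruct (factor_wle (proj1 L) _ _ j k hj (ex_intro _ g (eq_sym Eg))) as [g' Eg'].
      eauto. }
    split.
    + intros [X sX] [Y sY]. destruct (univ X I) as [p _]. destruct (univ Y I) as [q _].
      destruct (cospan X Y sX sY p q) as (j & f & g & _).
      exists (exist _ _ (smH j)), f, g. exact I.
    + intros [X sX] [Y sY] [Z sZ] f g. cbn in f, g.
      destruct (univ Y I) as [p _]. destruct (univ Z I) as [q _].
      destruct (homog X sX (p ∘ f) (q ∘ g)) as (h & _ & E).
      destruct (cospan Y Z sY sZ (h ∘ p) q) as (j & p' & q' & Ep & Eq).
      exists (exist _ _ (smH j)), q', p'. cbn. apply (mono _ _ (u j)).
      rewrite !comp_assoc, Ep, Eq, <- comp_assoc. exact E.
  - intros [JEP AP]. destruct (saturated_exists reg alg mono AP) as [U sat].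
    exists U. split.
    + apply (saturated_universal reg alg mono); assumption.
    + apply (saturated_homogeneous reg alg mono); assumption.
Qed.

(** * The comma category *)

(** A [mu] that embeds into [l] and into which [l] embeds is covered by neither hypothesis directly:
    it has the order type of [l] without being [l]. The embedding of [l] is then cofinal in [mu],
    and the claim passes to the subchain along it. *)
Lemma small_cocontinuous_le {l : WO} {A C : Category} (F : Functor A C) :
  small_cocontinuous l l F -> (forall mu, ord_lt mu l -> small_cocontinuous mu l F) ->
  forall mu, ord_le mu l -> small_cocontinuous mu l F.
Proof.
  intros Fl Fmu mu le. destruct (classic (ord_le l mu)) as [[e He] | N].
  2: { apply Fmu. split; assumption. }
  destruct le as [d Hd].
  assert (mon : forall i j, wle i j -> wle (e i) (e j)).
  { intros i j [<- | h]; [left; reflexivity | right; auto]. }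
  (* The composite of [d] and [e] is a strictly increasing self-map of a well-order, so it never
     lowers an index. *)
  assert (cof : forall i, exists x, wle i (e x)).
  { intros i. exists (d i). induction i as [i IH] using (well_founded_induction (wlt_wf mu)).
    destruct (wle_lt_dec i (e (d i))) as [h | h]; [exact h |].
    destruct (wlt_irrefl mu (e (d i))).
    exact (wle_lt_trans _ _ _ (IH _ h) (He _ _ (Hd _ _ h))). }
  intros H sm S f L.
  apply (cofinal_limiting (Fcomp F H) e mon cof).
  - intros i j h. etransitivity; [symmetry; apply (fmap_comp F) |].
    exact (f_equal (fmap F) (proj1 L i j h)).
  - refine (Fl (Fcomp H (reindex e mon)) _ S (fun x => f (e x)) _).
    + intros x; apply sm.
    + apply (cofinal_limiting H e mon cof); [apply L | exact L].
Qed.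

Section CommaCategory.
Context {A B C : Category} (F : Functor A C) (G : Functor B C).

Definition comma_fst : Functor (Comma F G) A.
Proof.
  refine {| fobj := (fun X => cA X) : Obj (Comma F G) -> Obj A;
            fmap := fun X Y (f : @Hom (Comma F G) X Y) => fst (proj1_sig f) |};
  reflexivity.
Defined.

Definition comma_snd : Functor (Comma F G) B.
Proof.
  refine {| fobj := (fun X => cB X) : Obj (Comma F G) -> Obj B;
            fmap := fun X Y (f : @Hom (Comma F G) X Y) => snd (proj1_sig f) |};
  reflexivity.
Defined.

Lemma comma_hom_eq {X Y : Obj (Comma F G)} (f g : Hom X Y) :
  fmap comma_fst f = fmap comma_fst g -> fmap comma_snd f = fmap comma_snd g -> f = g.
Proof. intros E1 E2. apply sig_eq_pi, injective_projections; assumption. Qed.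

Lemma comma_mono : all_mono A -> all_mono B -> all_mono (Comma F G).
Proof.
  intros MA MB X Y f V g h E. apply comma_hom_eq.
  - apply (MA _ _ (fmap comma_fst f)). exact (f_equal (fmap comma_fst) E).
  - apply (MB _ _ (fmap comma_snd f)). exact (f_equal (fmap comma_snd) E).
Qed.

Lemma comma_isomorphic {X Y : Obj (Comma F G)} (f : @Hom (Comma F G) X Y) :
  is_iso (fmap comma_fst f) -> is_iso (fmap comma_snd f) -> is_iso f.
Proof.
  destruct f as [[a b] e]; cbn. intros [a' [A1 A2]] [b' [B1 B2]]. cbn in e.
  assert (e' : comp (cf X) (fmap F a') = comp (fmap G b') (cf Y)).
  { transitivity (fmap G b' ∘ (fmap G b ∘ cf X) ∘ fmap F a').
    - rewrite (comp_assoc (cf X)), <- (fmap_comp G), B1, fmap_id, comp_idl. reflexivity.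
    - rewrite <- e, <- !comp_assoc, <- (fmap_comp F), A2, fmap_id, comp_idr. reflexivity. }
  exists (exist _ (a', b') e').
  split; apply comma_hom_eq; assumption.
Qed.

(** The two mediating morphisms must form a comma square. It commutes after precomposition with each
    leg under [F], and those legs are jointly epic because their cocone is limiting. *)
Lemma comma_limiting {D : Category} (H : Functor D (Comma F G)) (S : Obj (Comma F G))
  (c : forall i, @Hom (Comma F G) (fobj H i) S) :
  is_limiting (Fcomp comma_fst H) (cA S) (fun i => fmap comma_fst (c i)) ->
  is_limiting (Fcomp F (Fcomp comma_fst H)) (fobj F (cA S))
    (fun i => fmap F (fmap comma_fst (c i))) ->
  is_limiting (Fcomp comma_snd H) (cB S) (fun i => fmap comma_snd (c i)) ->
  is_limiting H S c.
Proof.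
  intros LA LF LB. apply limiting_intro.
  - intros i j h. apply comma_hom_eq; [apply LA | apply LB].
  - intros S' c' Hc'.
    destruct (limiting_mediate LA (cA S') (fun i => fmap comma_fst (c' i))) as [a Ha].
    { intros i j h. exact (f_equal (fmap comma_fst) (Hc' i j h)). }
    destruct (limiting_mediate LB (cB S') (fun i => fmap comma_snd (c' i))) as [b Hb].
    { intros i j h. exact (f_equal (fmap comma_snd) (Hc' i j h)). }
    assert (e : comp (cf S') (fmap F a) = comp (fmap G b) (cf S)).
    { apply (limiting_epi LF). intros i.
      rewrite <- !comp_assoc.
      etransitivity;
        [exact (f_equal (comp (cf S')) (eq_sym (fmap_comp F (fmap comma_fst (c i)) a))) |].
      etransitivity; [exact (f_equal (fun q => cf S' ∘ fmap F q) (Ha i)) |].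
      etransitivity; [exact (proj2_sig (c' i)) |].
      etransitivity; [| exact (f_equal (comp (fmap G b)) (eq_sym (proj2_sig (c i))))].
      etransitivity; [| symmetry; apply comp_assoc].
      etransitivity; [| exact (f_equal (fun q => q ∘ _) (fmap_comp G (fmap comma_snd (c i)) b))].
      exact (f_equal (fun q => fmap G q ∘ _) (eq_sym (Hb i))). }
    exists (exist _ (a, b) e). intros i. apply comma_hom_eq; [apply Ha | apply Hb].
  - intros X f g E. apply comma_hom_eq.
    + apply (limiting_epi LA). intros i. exact (f_equal (fmap comma_fst) (E i)).
    + apply (limiting_epi LB). intros i. exact (f_equal (fmap comma_snd) (E i)).
Qed.

(** The structure morphism [s] mediates the cocone with legs [fmap G (fB i) ∘ cf (fobj H i)] out of
    the colimit that [F] preserves. *)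
Lemma comma_colimit {D : Category} (H : Functor D (Comma F G)) SA SB fA fB :
  is_limiting (Fcomp comma_fst H) SA fA ->
  is_limiting (Fcomp F (Fcomp comma_fst H)) (fobj F SA)
    (cocone_image F (Fcomp comma_fst H) SA fA) ->
  is_limiting (Fcomp comma_snd H) SB fB ->
  exists s (c : forall i, @Hom (Comma F G) (fobj H i) (Build_CommaObj SA SB s)),
    (forall i, fst (proj1_sig (c i)) = fA i /\ snd (proj1_sig (c i)) = fB i) /\
    is_limiting H (Build_CommaObj SA SB s) c.
Proof.
  intros LA LF LB.
  destruct (limiting_mediate LF (fobj G SB) (fun i => fmap G (fB i) ∘ cf (fobj H i)))
    as [s Hs].
  { intros i j h.
    etransitivity; [symmetry; apply comp_assoc |].
    etransitivity; [exact (f_equal (comp (fmap G (fB j))) (proj2_sig (fmap H h))) |].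
    etransitivity; [apply comp_assoc |].
    etransitivity; [exact (f_equal (fun q => q ∘ _)
      (eq_sym (fmap_comp G (fmap comma_snd (fmap H h)) (fB j)))) |].
    exact (f_equal (fun q => fmap G q ∘ _) (proj1 LB i j h)). }
  exists s, (fun i => exist _ (fA i, fB i) (Hs i)). split; [auto |].
  apply comma_limiting; [exact LA | exact LF | exact LB].
Qed.

End CommaCategory.

Lemma is_iso_comp {K : Category} {X Y Z : Obj K} (f : Hom X Y) (g : Hom Y Z) :
  is_iso f -> is_iso g -> is_iso (g ∘ f).
Proof.
  intros [f' [F1 F2]] [g' [G1 G2]]. exists (f' ∘ g'). split.
  - rewrite comp_assoc, <- (comp_assoc g), G1, comp_idr. exact F1.
  - rewrite comp_assoc, <- (comp_assoc f'), F2, comp_idr. exact G2.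
Qed.

(** * Small objects, algebroidality, and transfer of joint embedding and amalgamation *)

Section CommaAlgebroidal.
Context {l : WO} (reg : regular_cardinal l) {A B C : Category}.
Context (F : Functor A C) (G : Functor B C).
Context (algA : algebroidal l A) (algB : algebroidal l B).
Context (MA : all_mono A) (MB : all_mono B).
Context (Fl : cocontinuous l F).
Context (Fmu : forall mu : WO, ord_lt mu l -> small_cocontinuous mu l F).
Context (FG : preserves_smallness l F G) (Gmono : preserves_mono G).
Context (homs : forall (X : Obj A) (Y : Obj B), small l X -> small l Y ->
  exists e : Hom (fobj F X) (fobj G Y) -> wcar l, injective e).

(** The given cocone is compared with the componentwise one by [m] and [m']. Smallness of the
    components factors both parts of [m ∘ h], and one later stage [k] serves both. *)
Lemma comma_small (X : Obj (Comma F G)) : small l (cA X) -> small l (cB X) -> small l X.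
Proof.
  intros sA sB H S f L h.
  destruct (chain_colimit reg MA (proj1 algA) (Fcomp (comma_fst F G) H)) as (SA & fA & LA).
  destruct (chain_colimit reg MB (proj1 algB) (Fcomp (comma_snd F G) H)) as (SB & fB & LB).
  destruct (comma_colimit F G H SA SB fA fB LA (Fl _ _ _ LA) LB) as (s & c & Ec & Lc).
  destruct (limiting_mediate L _ c (proj1 Lc)) as [m Hm].
  destruct (limiting_mediate Lc _ f (proj1 L)) as [m' Hm'].
  assert (E : m' ∘ m = idm S).
  { apply (limiting_epi L). intros i. rewrite <- comp_assoc, Hm, Hm', comp_idl; reflexivity. }
  destruct (sA _ _ _ LA (fmap (comma_fst F G) (m ∘ h))) as (j1 & g1 & E1).
  destruct (sB _ _ _ LB (fmap (comma_snd F G) (m ∘ h))) as (j2 & g2 & E2).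
  destruct (upper_bound2 j1 j2) as (k & k1 & k2).
  destruct (factor_wle (proj1 LA) _ _ j1 k k1 (ex_intro _ g1 (eq_sym E1))) as [a Ea].
  destruct (factor_wle (proj1 LB) _ _ j2 k k2 (ex_intro _ g2 (eq_sym E2))) as [b Eb].
  (* The factors [a] and [b] were found separately; their square commutes because it does so after
     the monic [fmap G (fB k)]. *)
  assert (sq : comp (cf (fobj H k)) (fmap F a) = comp (fmap G b) (cf X)).
  { apply (Gmono _ _ (fB k) (MB _ _ _)).
    etransitivity; [apply comp_assoc |].
    etransitivity; [| symmetry; apply comp_assoc].
    etransitivity; [| exact (f_equal (fun q => q ∘ cf X) (fmap_comp G b (fB k)))].
    etransitivity; [| exact (f_equal (fun q => fmap G q ∘ cf X) (eq_sym Eb))].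
    etransitivity; [| exact (proj2_sig (m ∘ h))].
    etransitivity; [| exact (f_equal (fun q => s ∘ fmap F q) Ea)].
    etransitivity; [| exact (f_equal (comp s) (eq_sym (fmap_comp F a (fA k))))].
    etransitivity; [| symmetry; apply comp_assoc].
    refine (f_equal (fun q => q ∘ fmap F a) _).
    etransitivity; [exact (f_equal (fun q => fmap G q ∘ _) (eq_sym (proj2 (Ec k)))) |].
    etransitivity; [symmetry; exact (proj2_sig (c k)) |].
    exact (f_equal (fun q => s ∘ fmap F q) (proj1 (Ec k))). }
  exists k, (exist _ (a, b) sq).
  transitivity (m' ∘ (m ∘ h)); [rewrite comp_assoc, E, comp_idl; reflexivity |].
  rewrite <- Hm', <- comp_assoc. f_equal. apply comma_hom_eq.
  - etransitivity; [symmetry; exact Ea |]. exact (f_equal (fun q => q ∘ a) (eq_sym (proj1 (Ec k)))).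
  - etransitivity; [symmetry; exact Eb |]. exact (f_equal (fun q => q ∘ b) (eq_sym (proj2 (Ec k)))).
Qed.

(** Smallness is stated for the components because smallness in the comma category is characterized
    only afterwards, with the help of this decomposition. *)
Lemma comma_decomposition (X : Obj (Comma F G)) :
  exists H : Functor (WOcat l) (Comma F G),
    (forall i, small l (cA (fobj H i)) /\ small l (cB (fobj H i))) /\
    exists c : forall i, Hom (fobj H i) X, is_limiting H X c.
Proof.
  destruct (proj2 (proj1 algA) (cA X)) as (HA & sA & a & LA).
  destruct (proj2 (proj1 algB) (cB X)) as (HB & sB & b & LB).
  assert (CG : is_cocone (Fcomp G HB) (fobj G (cB X)) (cocone_image G HB (cB X) b)).
  { intros i j h. etransitivity; [symmetry; apply (fmap_comp G) |].
    exact (f_equal (fmap G) (proj1 LB i j h)). }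
  (* The clauses make [j] cofinal, so that [cB X] stays the colimit of the reindexed chain;
     monotone, so that reindexing is possible; and large enough for the structure morphism
     restricted to [fobj HA i] to factor. *)
  destruct (wf_dep_choice (wcar l) wlt (wlt_wf l) (fun _ => wcar l) (fun i h x =>
    wle i x /\ (forall i' hi, wle (h i' hi) x) /\
    exists g : Hom (fobj F (fobj HA i)) (fobj G (fobj HB x)),
      fmap G (b x) ∘ g = cf X ∘ fmap F (a i))) as [j Hj].
  { intros _; apply reg. }
  { intros i h _.
    destruct (FG HB (cB X) b LB (fobj HA i) (sA i) (cf X ∘ fmap F (a i))) as (x & g & E).
    destruct (seg_eventually reg i (fun i' _ y => wle (h i') y)) as [y Hy].
    { intros i' _ y y' Hy Hh. exact (wle_trans Hh Hy). }
    { intros i' _. exists (h i'). apply wle_refl. }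
    destruct (upper_bound2 i y) as (z & Z1 & Z2).
    destruct (upper_bound2 x z) as (w & W1 & W2).
    exists w. split; [exact (wle_trans Z1 W2) | split].
    - intros i' hi. exact (wle_trans (Hy i' hi) (wle_trans Z2 W2)).
    - exact (factor_wle CG _ _ x w W1 (ex_intro _ g E)). }
  assert (mon : forall i i', wle i i' -> wle (j i) (j i')).
  { intros i i' [<- | h]; [left; reflexivity | apply (Hj i' ), h]. }
  assert (cof : forall i, exists x, wle i (j x)) by (intros i; exists i; apply Hj).
  destruct (dep_choice (wcar l) (fun i => Hom (fobj F (fobj HA i)) (fobj G (fobj HB (j i))))
    (fun i g => fmap G (b (j i)) ∘ g = cf X ∘ fmap F (a i))) as [g Hg].
  { intros i; apply Hj. }
  pose (Z := fun i => Build_CommaObj (F := F) (G := G) (fobj HA i) (fobj HB (j i)) (g i)).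
  assert (sq : forall i i' (h : wle i i'),
    g i' ∘ fmap F (fmap HA (h : @Hom (WOcat l) i i'))
    = fmap G (fmap HB (mon i i' h : @Hom (WOcat l) (j i) (j i'))) ∘ g i).
  { intros i i' h. apply (Gmono _ _ (b (j i')) (MB _ _ _)).
    rewrite !comp_assoc, Hg, <- comp_assoc, <- (fmap_comp F), <- (fmap_comp G).
    rewrite (proj1 LA i i' h), (proj1 LB (j i) (j i') (mon i i' h)), Hg. reflexivity. }
  unshelve epose (H := chain (K := Comma F G) Z (fun i i' h => exist _
    (fmap HA (h : @Hom (WOcat l) i i'),
     fmap HB (mon i i' h : @Hom (WOcat l) (j i) (j i'))) (sq i i' h)) _ _).
  { intros i. apply comma_hom_eq; [apply (fmap_wle_refl HA) | apply (fmap_wle_refl HB)]. }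
  { intros i i' i'' h h'. apply comma_hom_eq; symmetry; [apply fmap_wle | ].
    apply (fmap_wle HB (mon i i' h) (mon i' i'' h')). }
  exists H. split; [intros i; split; [apply sA | apply sB] |].
  exists (fun i => exist (fun p : Hom (cA (Z i)) (cA X) * Hom (cB (Z i)) (cB X) =>
    cf X ∘ fmap F (fst p) = fmap G (snd p) ∘ cf (Z i)) (a i, b (j i)) (eq_sym (Hg i))).
  apply comma_limiting.
  - exact LA.
  - exact (Fl HA _ _ LA).
  - exact (proj1 (cofinal_limiting HB j mon cof _ _ (proj1 LB)) LB).
Qed.

(** The identity of a small [X] factors through a stage of its decomposition, so each component of
    [X] is a retract of a small object. *)
Lemma comma_small_iff (X : Obj (Comma F G)) : small l X <-> small l (cA X) /\ small l (cB X).
Proof.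
  split; [| intros [sA sB]; apply comma_small; assumption].
  intros sX. destruct (comma_decomposition X) as (H & sH & c & L).
  destruct (sX H X c L (idm X)) as (j & g & E). split.
  - refine (small_retract (fmap (comma_fst F G) g) (fmap (comma_fst F G) (c j)) _ (proj1 (sH j))).
    symmetry. exact (f_equal (fmap (comma_fst F G)) E).
  - refine (small_retract (fmap (comma_snd F G) g) (fmap (comma_snd F G) (c j)) _ (proj2 (sH j))).
    symmetry. exact (f_equal (fmap (comma_snd F G)) E).
Qed.

(** The code combines those of the two components with the index of the structure morphism after
    transport to the representatives. The transport depends on the chosen isomorphisms, hence the
    relation [normal]; objects sharing a normal form are isomorphic through it. *)
Lemma comma_code :
  exists code : Obj (SmallSub l (Comma F G)) -> wcar l,
    forall X Y, code X = code Y -> isomorphic X Y.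
Proof.
  destruct (pairing reg) as [p Hp].
  destruct (representatives reg algA) as (codeA & RA & HA).
  destruct (representatives reg algB) as (codeB & RB & HB).
  destruct (dep_choice3 (wcar l) (wcar l) (fun _ _ => True)
    (fun a b _ => Hom (fobj F (proj1_sig (RA a))) (fobj G (proj1_sig (RB b))) -> wcar l)
    (fun a b _ e => injective e)) as [hc Hhc].
  { intros a b _. apply homs; [exact (proj2_sig (RA a)) | exact (proj2_sig (RB b))]. }
  pose (normal := fun (X : Obj (Comma F G)) a b
      (r : Hom (fobj F (proj1_sig (RA a))) (fobj G (proj1_sig (RB b)))) =>
    exists (u : Hom (cA X) (proj1_sig (RA a))) (u' : Hom (proj1_sig (RA a)) (cA X))
      (v : Hom (cB X) (proj1_sig (RB b))),
      u' ∘ u = idm _ /\ u ∘ u' = idm _ /\ is_iso v /\ r = fmap G v ∘ cf X ∘ fmap F u').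
  assert (norm_iso : forall X Y a b r, normal X a b r -> normal Y a b r -> isomorphic X Y).
  { intros X Y a b r (u & u' & v & U1 & U2 & (v' & V1 & V2) & ->)
      (w & w' & z & W1 & W2 & (z' & Z1 & Z2) & E).
    assert (sq : cf Y ∘ fmap F (w' ∘ u) = fmap G (z' ∘ v) ∘ cf X).
    { rewrite (fmap_comp F), (fmap_comp G).
      transitivity (fmap G z' ∘ (fmap G z ∘ cf Y ∘ fmap F w') ∘ fmap F u).
      - rewrite !comp_assoc, <- (fmap_comp G), Z1, (fmap_id G), comp_idl. reflexivity.
      - rewrite <- E, <- !comp_assoc, <- (fmap_comp F), U1, (fmap_id F), comp_idr.
        reflexivity. }
    exists (exist _ (w' ∘ u, z' ∘ v) sq : @Hom (Comma F G) X Y).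
    apply comma_isomorphic; cbn; apply is_iso_comp.
    - exists u'; split; assumption.
    - exists w; split; assumption.
    - exists v'; split; assumption.
    - exists z; split; assumption. }
  destruct (dep_choice (Obj (SmallSub l (Comma F G))) (fun _ => wcar l)
    (fun X c => exists a b r, normal (proj1_sig X) a b r /\
       c = p (p (a, b), hc a b I r))) as [code Hcode].
  { intros [X sX]. destruct (proj1 (comma_small_iff X) sX) as [sA sB].
    destruct (HA (exist _ _ sA)) as (u & u' & U1 & U2).
    destruct (HB (exist _ _ sB)) as (v & V).
    eexists. eexists _, _, _. split; [| reflexivity].
    exists u, u', v. split; [exact U1 | split; [exact U2 | split; [exact V | reflexivity]]]. }
  exists code. intros X Y E.
  destruct (Hcode X) as (a & b & r & N & Ex). destruct (Hcode Y) as (a' & b' & r' & N' & Ey).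
  rewrite Ex, Ey in E. apply Hp in E. injection E as E1 E2.
  apply Hp in E1. injection E1 as <- <-. apply Hhc in E2. subst r'.
  exact (norm_iso _ _ _ _ _ N N').
Qed.

Lemma comma_algebroidal : algebroidal l (Comma F G).
Proof.
  split; [split | split].
  - intros mu le H sH.
    assert (sHA : forall i, small l (cA (fobj H i))) by (intros i; apply comma_small_iff, sH).
    assert (sHB : forall i, small l (cB (fobj H i))) by (intros i; apply comma_small_iff, sH).
    destruct (proj1 (proj1 algA) mu le (Fcomp (comma_fst F G) H) sHA) as (SA & fA & LA).
    destruct (proj1 (proj1 algB) mu le (Fcomp (comma_snd F G) H) sHB) as (SB & fB & LB).
    assert (LF := small_cocontinuous_le F (fun H _ => Fl H) Fmu mu le
      (Fcomp (comma_fst F G) H) sHA SA fA LA).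
    destruct (comma_colimit F G H SA SB fA fB LA LF LB) as (s & c & _ & Lc). eauto.
  - intros X. destruct (comma_decomposition X) as (H & sH & L).
    exists H. split; [| exact L]. intros i. apply comma_small_iff, sH.
  - exact comma_code.
  - intros X Y sX sY. apply (proj1 (comma_small_iff _)) in sX, sY.
    destruct (proj2 (proj2 algA) (cA X) (cA Y)) as [ea Ha]; try tauto.
    destruct (proj2 (proj2 algB) (cB X) (cB Y)) as [eb Hb]; try tauto.
    destruct (pairing reg) as [p Hp].
    exists (fun f : @Hom (Comma F G) X Y =>
      p (ea (fmap (comma_fst F G) f), eb (fmap (comma_snd F G) f))).
    intros f g E. apply Hp in E. injection E as E1 E2.
    apply comma_hom_eq; auto.
Qed.

(** The (F,G)-property starts from one common target [T]. Two comma objects come with different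
    targets, which joint embedding of small objects of B brings together first. *)
Lemma comma_jep :
  jep (SmallSub l B) ->
  jep (SmallSub l (Comma F G)) <-> fg_jep (Restrict F (@small l A)) (Restrict G (@small l B)).
Proof.
  intros JB. split.
  - intros J [X sX] [Y sY] [T sT] h k. cbn in h, k.
    destruct (J (exist _ (Build_CommaObj X T h) (comma_small (Build_CommaObj X T h) sX sT))
                (exist _ (Build_CommaObj Y T k) (comma_small (Build_CommaObj Y T k) sY sT)))
      as ([D sD] & f & g & _).
    cbn in f, g. destruct (proj1 (comma_small_iff D) sD) as [sDA sDB].
    exists (exist _ _ sDA), (exist _ _ sDB), (fst (proj1_sig f)), (fst (proj1_sig g)),
      (cf D), (snd (proj1_sig f)), (snd (proj1_sig g)).
    split; [exact (proj2_sig f) | exact (proj2_sig g)].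
  - intros J [X sX] [Y sY].
    destruct (proj1 (comma_small_iff X) sX) as [sXA sXB].
    destruct (proj1 (comma_small_iff Y) sY) as [sYA sYB].
    destruct (JB (exist _ _ sXB) (exist _ _ sYB)) as ([T sT] & t1 & t2 & _). cbn in t1, t2.
    destruct (J (exist _ _ sXA) (exist _ _ sYA) (exist _ T sT)
      (fmap G t1 ∘ cf X) (fmap G t2 ∘ cf Y))
      as ([D sD] & [T' sT'] & f1 & f2 & h & k1 & k2 & E1 & E2).
    cbn in f1, f2, h, k1, k2.
    assert (S1 : h ∘ fmap F f1 = fmap G (k1 ∘ t1) ∘ cf X).
    { rewrite (fmap_comp G), <- comp_assoc. exact E1. }
    assert (S2 : h ∘ fmap F f2 = fmap G (k2 ∘ t2) ∘ cf Y).
    { rewrite (fmap_comp G), <- comp_assoc. exact E2. }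
    exists (exist _ (Build_CommaObj D T' h) (comma_small (Build_CommaObj D T' h) sD sT')).
    exists (exist _ (f1, k1 ∘ t1) S1), (exist _ (f2, k2 ∘ t2) S2). exact I.
Qed.

Lemma comma_ap :
  ap (SmallSub l B) ->
  ap (SmallSub l (Comma F G)) <-> fg_ap (Restrict F (@small l A)) (Restrict G (@small l B)).
Proof.
  intros AB. split.
  - intros AP [X sX] [Y sY] [Z sZ] f g [T sT] h k E. cbn in f, g, h, k, E.
    pose (P := Build_CommaObj (F := F) (G := G) X T (h ∘ fmap F f)).
    assert (e1 : h ∘ fmap F f = fmap G (idm T) ∘ cf P).
    { rewrite (fmap_id G), comp_idl. reflexivity. }
    assert (e2 : k ∘ fmap F g = fmap G (idm T) ∘ cf P).
    { rewrite (fmap_id G), comp_idl. symmetry; exact E. }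
    destruct (AP (exist _ P (comma_small P sX sT))
      (exist _ (Build_CommaObj Y T h) (comma_small (Build_CommaObj Y T h) sY sT))
      (exist _ (Build_CommaObj Z T k) (comma_small (Build_CommaObj Z T k) sZ sT))
      (exist _ (f, idm T) e1) (exist _ (g, idm T) e2)) as ([D sD] & g2 & g1 & Eg).
    cbn in g1, g2. destruct (proj1 (comma_small_iff D) sD) as [sDA sDB].
    exists (exist _ _ sDA), (fst (proj1_sig g1)), (fst (proj1_sig g2)).
    split; [exact (f_equal (fun q => fst (proj1_sig q)) Eg) |].
    exists (exist _ _ sDB), (snd (proj1_sig g1)), (cf D). split; [exact (proj2_sig g1) |].
    (* Both legs of the span out of [P] are the identity on [T], so commutativity of the amalgam
       identifies its two B-components; this is the single [k] that is required. *)
    assert (snd (proj1_sig g1) = snd (proj1_sig g2)) as ->; [| exact (proj2_sig g2)].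
    assert (Es := f_equal (fun q => snd (proj1_sig q)) Eg). cbn in Es.
    rewrite !comp_idr in Es. exact Es.
  - intros AP [X sX] [Y sY] [Z sZ] f g. cbn in f, g.
    destruct (proj1 (comma_small_iff X) sX) as [sXA sXB].
    destruct (proj1 (comma_small_iff Y) sY) as [sYA sYB].
    destruct (proj1 (comma_small_iff Z) sZ) as [sZA sZB].
    (* Amalgamating the B-components first produces the common target [T], over which the two
       structure morphisms agree on [X]. *)
    destruct (AB (exist _ _ sXB) (exist _ _ sYB) (exist _ _ sZB) (snd (proj1_sig f))
      (snd (proj1_sig g))) as ([T sT] & t2 & t1 & Et). cbn in t1, t2, Et.
    destruct (AP (exist _ _ sXA) (exist _ _ sYA) (exist _ _ sZA) (fst (proj1_sig f))
      (fst (proj1_sig g)) (exist _ T sT) (fmap G t1 ∘ cf Y) (fmap G t2 ∘ cf Z))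
      as ([D sD] & g1 & g2 & Eg & [T' sT'] & k & h & E1 & E2).
    + cbn. rewrite <- !comp_assoc, (proj2_sig f), (proj2_sig g), !comp_assoc,
        <- !(fmap_comp G), Et. reflexivity.
    + cbn in g1, g2, Eg, k, h.
      assert (S1 : h ∘ fmap F g1 = fmap G (k ∘ t1) ∘ cf Y).
      { rewrite (fmap_comp G), <- comp_assoc. exact E1. }
      assert (S2 : h ∘ fmap F g2 = fmap G (k ∘ t2) ∘ cf Z).
      { rewrite (fmap_comp G), <- comp_assoc. exact E2. }
      exists (exist _ (Build_CommaObj D T' h) (comma_small (Build_CommaObj D T' h) sD sT')).
      exists (exist _ (g2, k ∘ t2) S2), (exist _ (g1, k ∘ t1) S1).
      apply comma_hom_eq; [exact Eg |]. cbn.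
      rewrite <- !comp_assoc, Et. reflexivity.
Qed.

End CommaAlgebroidal.

Theorem theorem2p13 (l : WO) (A B C : Category) (F : Functor A C) (G : Functor B C) :
  regular_cardinal l ->
  algebroidal l A -> algebroidal l B ->
  all_mono A -> all_mono B ->
  jep (SmallSub l B) -> ap (SmallSub l B) ->
  (* (1) *)
  cocontinuous l F ->
  (forall mu : WO, ord_lt mu l -> small_cocontinuous mu l F) ->
  (* (2) *)
  preserves_smallness l F G ->
  (* (3) *)
  small_cocontinuous l l G ->
  (* (4) *)
  preserves_mono G ->
  (* (5) *)
  (forall (X : Obj A) (Y : Obj B), small l X -> small l Y ->
     exists e : Hom (fobj F X) (fobj G Y) -> wcar l, injective e) ->
  ((exists U : Obj (Comma F G),
      universal_for (fun _ => True) U /\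
      homogeneous_for (@small l (Comma F G)) U)
   <->
   (fg_jep (Restrict F (@small l A)) (Restrict G (@small l B)) /\
    fg_ap (Restrict F (@small l A)) (Restrict G (@small l B)))).
Proof.
  intros reg algA algB MA MB JB AB Fl Fmu FG _ Gmono homs.
  rewrite <- (comma_jep reg F G algA algB MA MB Fl FG Gmono JB),
    <- (comma_ap reg F G algA algB MA MB Fl FG Gmono AB).
  apply droste_goebel; [exact reg | | apply comma_mono; assumption].
  exact (comma_algebroidal reg F G algA algB MA MB Fl Fmu FG Gmono homs).
Qed.
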